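(* Let $\Sigma$ be an anisotropic minimal surface of the Dirichlet energy in $\mathbb{R}^3$ (that is, with anisotropic mean curvature $\Lambda=0$). If $\Sigma$ is a cyclic surface, then the planes of the foliation are all parallel to the $xy$-plane.
   Context: Let $\Sigma$ be an oriented surface immersed in Euclidean space $\mathbb{R}^3$ (coordinates $(x,y,z)$) with unit normal $\nu=(\nu_1,\nu_2,\nu_3)$. The Dirichlet energy of $\Sigma$ is $\mathcal{F}(\Sigma)=\int_\Sigma F(\nu)\,d\Sigma$ with $F(\nu)=\frac{1}{\nu_3}-\nu_3$, where it is understood that $\nu_3\neq 0$; if $\Sigma$ is the graph $z=u(x,y)$ over $\Omega\subset\mathbb{R}^2$, this equals $\int_\Omega|Du|^2$. The anisotropic mean curvature of $\Sigma$ is $\Lambda=2HF-\mathrm{div}_\Sigma DF$, where $H$ is the mean curvature of $\Sigma$ and $DF$ is the gradient of $F$ on the unit sphere $\mathbb{S}^2$. $\Sigma$ is an anisotropic minimal surface if $\Lambda=0$; for a graph $z=u(x,y)$ this means $u_{xx}+u_{yy}=0$. A surface of $\mathbb{R}^3$ is a cyclic surface if it is foliated by a smooth one-parameter family of circles (not necessarily of the same radius); the planes containing these circles are called the planes of the foliation.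
   Formalization: The surface Σ is additionally assumed not to be contained in a plane: a tilted plane minus a point has Λ = 0 and is foliated by concentric circles lying in that non-horizontal plane, so the claim fails there. *)

(* Defs.v *)
From Stdlib Require Import Reals.
From Coquelicot Require Import Coquelicot.

Open Scope R_scope.

Definition V3 : Type := (R * R * R)%type.

Definition xc (p : V3) : R := fst (fst p).
Definition yc (p : V3) : R := snd (fst p).
Definition zc (p : V3) : R := snd p.

Definition dot (p q : V3) : R := xc p * xc q + yc p * yc q + zc p * zc q.

Definition cross (p q : V3) : V3 :=
  (yc p * zc q - zc p * yc q, zc p * xc q - xc p * zc q, xc p * yc q - yc p * xc q).

Definition norm3 (p : V3) : R := sqrt (dot p p).

Definition zero3 : V3 := (0, 0, 0).

(** * Planes *)

Definition is_plane (P : V3 -> Prop) : Prop :=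
  exists p n : V3, n <> zero3 /\ forall q : V3, P q <-> dot (minus q p) n = 0.

(* Parallel planes are translates of each other; a plane is parallel to itself. *)
Definition parallel (P Q : V3 -> Prop) : Prop :=
  exists w : V3, forall q : V3, P q <-> Q (plus q w).

Definition xy_plane (q : V3) : Prop := zc q = 0.

(** * Immersed surfaces *)

(* C^infinity on U; [ex_diff_n f n u v] says that all mixed partial derivatives
   of order at most n, in any order, exist and are continuous at (u, v). *)
Definition smooth_on (U : R * R -> Prop) (f : R -> R -> R) : Prop :=
  forall u v : R, U (u, v) -> forall n : nat, ex_diff_n f n u v.

Definition smooth3_on (U : R * R -> Prop) (X : R -> R -> V3) : Prop :=
  smooth_on U (fun u v => xc (X u v)) /\
  smooth_on U (fun u v => yc (X u v)) /\
  smooth_on U (fun u v => zc (X u v)).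

Definition d_u (X : R -> R -> V3) (u v : R) : V3 :=
  (Derive (fun s => xc (X s v)) u,
   Derive (fun s => yc (X s v)) u,
   Derive (fun s => zc (X s v)) u).

Definition d_v (X : R -> R -> V3) (u v : R) : V3 :=
  (Derive (fun s => xc (X u s)) v,
   Derive (fun s => yc (X u s)) v,
   Derive (fun s => zc (X u s)) v).

(* The immersion X : U -> R^3 need not be injective.  The surface is oriented by
   the parameters (u, v); exchanging them gives the other orientation. *)
Definition immersed_surface (U : R * R -> Prop) (X : R -> R -> V3) : Prop :=
  open U /\ smooth3_on U X /\
  forall u v : R, U (u, v) -> cross (d_u X u v) (d_v X u v) <> zero3.

Definition unit_normal (X : R -> R -> V3) (u v : R) : V3 :=
  let w := cross (d_u X u v) (d_v X u v) in scal (/ norm3 w) w.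

(* g^{ij} <d_i V, d_j X>, where g is the first fundamental form of X and V is an
   R^3-valued vector field along X. *)
Definition div_surface (X V : R -> R -> V3) (u v : R) : R :=
  let Xu := d_u X u v in let Xv := d_v X u v in
  let Vu := d_u V u v in let Vv := d_v V u v in
  let g11 := dot Xu Xu in let g12 := dot Xu Xv in let g22 := dot Xv Xv in
  (g22 * dot Vu Xu - g12 * (dot Vu Xv + dot Vv Xu) + g11 * dot Vv Xv)
  / (g11 * g22 - g12 * g12).

(* Half the trace of the shape operator - d nu; this sign of H is the one for
   which 2 H F - div DF vanishes on graphs exactly when u_xx + u_yy = 0. *)
Definition mean_curvature (X : R -> R -> V3) (u v : R) : R :=
  - div_surface X (unit_normal X) u v / 2.

(** * Anisotropic energies *)

Definition gradient (F : V3 -> R) (p : V3) : V3 :=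
  (Derive (fun t => F (t, yc p, zc p)) (xc p),
   Derive (fun t => F (xc p, t, zc p)) (yc p),
   Derive (fun t => F (xc p, yc p, t)) (zc p)).

(* Gradient on the unit sphere, at a unit vector n, of the restriction of F: the
   tangential part of the gradient of F in R^3, which only depends on the
   restriction of F to the sphere. *)
Definition sphere_gradient (F : V3 -> R) (n : V3) : V3 :=
  minus (gradient F n) (scal (dot (gradient F n) n) n).

Definition anisotropic_mean_curvature (F : V3 -> R) (X : R -> R -> V3) (u v : R) : R :=
  2 * mean_curvature X u v * F (unit_normal X u v)
  - div_surface X (fun s t => sphere_gradient F (unit_normal X s t)) u v.

Definition dirichlet_integrand (n : V3) : R := / zc n - zc n.

Definition dirichlet_minimal_surface (U : R * R -> Prop) (X : R -> R -> V3) : Prop :=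
  immersed_surface U X /\
  forall u v : R, U (u, v) ->
    zc (unit_normal X u v) <> 0 /\
    anisotropic_mean_curvature dirichlet_integrand X u v = 0.

(** * Circle foliations *)

(* A family of circles indexed by an open interval, bounded or not; e1 and e2
   span the direction of the plane of each circle. *)
Record circle_family : Type := {
  lo : Rbar;
  hi : Rbar;
  center : R -> V3;
  radius : R -> R;
  e1 : R -> V3;
  e2 : R -> V3
}.

Definition index (C : circle_family) (s : R) : Prop :=
  Rbar_lt (lo C) s /\ Rbar_lt s (hi C).

Definition circle_point (C : circle_family) (s t : R) : V3 :=
  plus (center C s)
       (scal (radius C s) (plus (scal (cos t) (e1 C s)) (scal (sin t) (e2 C s)))).

Definition smooth_curve_on (J : R -> Prop) (c : R -> V3) : Prop :=
  forall s : R, J s -> forall n : nat,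
    ex_derive_n (fun r => xc (c r)) n s /\
    ex_derive_n (fun r => yc (c r)) n s /\
    ex_derive_n (fun r => zc (c r)) n s.

Definition smooth_circle_family (C : circle_family) : Prop :=
  smooth_curve_on (index C) (center C) /\
  smooth_curve_on (index C) (e1 C) /\
  smooth_curve_on (index C) (e2 C) /\
  (forall s : R, index C s -> forall n : nat, ex_derive_n (radius C) n s) /\
  forall s : R, index C s ->
    0 < radius C s /\
    dot (e1 C s) (e1 C s) = 1 /\ dot (e2 C s) (e2 C s) = 1 /\
    dot (e1 C s) (e2 C s) = 0.

(* (phi, psi) induces a diffeomorphism from (lo, hi) x (R / 2 pi Z) onto the
   parameter domain U, and X maps its leaf of index s once around the circle of
   index s.  In particular the leaves are pairwise disjoint and cover U. *)
Definition foliated_by (U : R * R -> Prop) (X : R -> R -> V3) (C : circle_family) : Prop :=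
  smooth_circle_family C /\
  exists phi psi : R -> R -> R,
    let S := fun p : R * R => index C (fst p) in
    smooth_on S phi /\ smooth_on S psi /\
    (forall s t : R, index C s -> U (phi s t, psi s t)) /\
    (forall u v : R, U (u, v) ->
       exists s t : R, index C s /\ phi s t = u /\ psi s t = v) /\
    (forall s t s' t' : R, index C s -> index C s' ->
       (phi s t = phi s' t' /\ psi s t = psi s' t' <->
        s = s' /\ exists k : Z, t' = t + 2 * PI * IZR k)) /\
    (forall s t : R, index C s ->
       Derive (fun r => phi r t) s * Derive (fun r => psi s r) t
       - Derive (fun r => phi s r) t * Derive (fun r => psi r t) s <> 0) /\
    (forall s t : R, index C s ->
       X (phi s t) (psi s t) = circle_point C s t).

(* A plane of the foliation: one that contains a circle of the family. *)
Definition foliation_plane (C : circle_family) (P : V3 -> Prop) : Prop :=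
  is_plane P /\
  exists s : R, index C s /\ forall t : R, P (circle_point C s t).

(* Concentric circles foliate an annulus of any plane, horizontal or not, and the
   affine functions are harmonic; there the circles have a single plane instead
   of a one-parameter family of planes. *)
Definition planar (U : R * R -> Prop) (X : R -> R -> V3) : Prop :=
  exists P : V3 -> Prop, is_plane P /\ forall u v : R, U (u, v) -> P (X u v).

(* Main.v *)
Require Import Defs.
From Stdlib Require Import Reals Lra Lia Psatz.
From Coquelicot Require Import Coquelicot.
Open Scope R_scope.

(** Write [p = x + i y] and let [f = z_x - i z_y] on the surface, locally a graph;
    minimality means that [f] is a holomorphic function of [p].  On the circle of
    index [s] the point is a trigonometric polynomial of degree 1 in [t], and
    [f_s p_t = f_t p_s], cleared of denominators, is a trigonometric polynomial of
    degree 5 that vanishes for all [t].  Writing the circle as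
    [c + cos t a + sin t b] and [V = a - i b], which is isotropic, the leading
    coefficient is a multiple of [V_z^2 det (V, V', V'')], and isotropy gives
    [det (V, V', V'')^2] as a multiple of [(V'.V')^3].  Hence at each [s] either the
    circle is horizontal, or [V'.V' = 0], which makes [V'] a multiple of [V], so
    that the direction of the plane of the circle is stationary.  In both cases
    the tilt of the plane is stationary, so it is constant along the foliation.

    If it is not zero, all the planes have a common normal [n].  Then [n.X] depends
    on [s] only, and averaging the minimal surface equation over antipodal points
    of one circle, at three values of [t], forces [n.X] to be constant: the surface
    is planar. *)

(** * Trigonometric polynomials *)

(** At a fixed [s], taking the top Fourier coefficient turns the differential equation into algebra:
    each factor is replaced by its [e^(i t)] coefficient and [d/dt] by multiplication by [i]. So
    only a second-order jet at one [s] enters, and the resulting alternative is pointwise: it may a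
    priori switch from one [s] to another. The tilt is a quantity whose derivative vanishes under
    either alternative, which avoids studying the sets where each one holds. Once it is constant and
    nonzero, the second alternative holds everywhere and the normal itself can be followed.

    When the planes are parallel, [V], [V'], [V''] are coplanar and the leading coefficient vanishes
    identically, so it says nothing more; this is why the last step needs another argument. That one
    exploits that a tilted circle projects to an ellipse which is not a circle: comparing a few
    values of [t] then isolates a sum of squares that must vanish. *)

(** Polynomial functions of degree at most [n] in Horner form. Only the coefficient [l] of [z^n],
    possibly zero, is recorded, since it is the only one read off in the end. *)
Fixpoint pol (n : nat) (g : C -> C) (l : C) : Prop :=
  match n with
  | O => forall z, g z = l
  | S n => exists h b, pol n h l /\ forall z, g z = (z * h z + b)%C
  end.

Lemma pol_ext n : forall f g l, (forall z, f z = g z) -> pol n f l -> pol n g l.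
Proof.
  destruct n as [|n]; simpl; intros f g l E H.
  - intros z; rewrite <- E; apply H.
  - destruct H as (h & b & Hh & Hf); exists h, b; split; auto.
    intros z; rewrite <- E; apply Hf.
Qed.

Lemma pol_plus n : forall f g a b,
  pol n f a -> pol n g b -> pol n (fun z => f z + g z)%C (a + b)%C.
Proof.
  induction n as [|n IH]; simpl; intros f g a b Hf Hg.
  - intros z; rewrite Hf, Hg; reflexivity.
  - destruct Hf as (f1 & a1 & Hf1 & Ef), Hg as (g1 & b1 & Hg1 & Eg).
    exists (fun z => f1 z + g1 z)%C, (a1 + b1)%C; split; [apply IH; assumption|].
    intros z; rewrite Ef, Eg; ring.
Qed.

Lemma pol_scal n : forall (k : C) f a,
  pol n f a -> pol n (fun z => k * f z)%C (k * a)%C.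
Proof.
  induction n as [|n IH]; simpl; intros k f a Hf.
  - intros z; rewrite Hf; reflexivity.
  - destruct Hf as (f1 & a1 & Hf1 & Ef).
    exists (fun z => k * f1 z)%C, (k * a1)%C; split; [apply IH; assumption|].
    intros z; rewrite Ef; ring.
Qed.

Lemma pol_raise n : forall f a, pol n f a -> pol (S n) f 0%C.
Proof.
  induction n as [|n IH]; intros f a Hf.
  - exists (fun _ => 0%C), a; split; [intros z; reflexivity|].
    intros z; rewrite Hf; ring.
  - destruct Hf as (f1 & a1 & Hf1 & Ef); exists f1, a1; split; [|exact Ef].
    apply (IH f1 a Hf1).
Qed.

Lemma pol_raise_le n m f a : (n < m)%nat -> pol n f a -> pol m f 0%C.
Proof.
  induction 1 as [|m Hm IH]; intros Hf.
  - exact (pol_raise n f a Hf).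
  - exact (pol_raise m f _ (IH Hf)).
Qed.

Lemma pol_mult n : forall m f g a b,
  pol n f a -> pol m g b -> pol (n + m) (fun z => f z * g z)%C (a * b)%C.
Proof.
  induction n as [|n IH]; intros m f g a b Hf Hg.
  - apply pol_ext with (fun z => a * g z)%C; [intros z; rewrite Hf; reflexivity|].
    exact (pol_scal m a g b Hg).
  - destruct Hf as (f1 & a1 & Hf1 & Ef).
    apply pol_ext with (fun z => z * (f1 z * g z) + a1 * g z)%C.
    { intros z; rewrite Ef; ring. }
    replace (a * b)%C with (a * b + 0)%C by ring.
    apply pol_plus.
    + exists (fun z => f1 z * g z)%C, 0%C; split; [exact (IH m f1 g a b Hf1 Hg)|].
      intros z; ring.
    + apply pol_raise_le with m (a1 * b)%C; [lia|exact (pol_scal m a1 g b Hg)].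
Qed.

(** Factor theorem. If [g z = z g1 z + b], then [g z - g w = (z - w) g1 z + w (g1 z - g1 w)]; the
    last difference contributes a quotient of lower degree, so the leading coefficient is that of
    [g1]. *)
Lemma pol_factor n : forall g l w, pol (S n) g l ->
  exists h, pol n h l /\ forall z, (g z - g w)%C = ((z - w) * h z)%C.
Proof.
  induction n as [|n IH]; intros g l w (g1 & b & Hg1 & Eg).
  - exists g1; split; [exact Hg1|]. intros z; rewrite !Eg, !Hg1; ring.
  - destruct (IH g1 l w Hg1) as (h1 & Hh1 & Eh1).
    exists (fun z => g1 z + w * h1 z)%C; split.
    + replace l with (l + 0)%C by ring. apply pol_plus; [exact Hg1|].
      exact (pol_raise n _ _ (pol_scal n w h1 l Hh1)).
    + intros z; rewrite !Eg.
      replace ((z - w) * (g1 z + w * h1 z))%C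
        with ((z - w) * g1 z + w * ((z - w) * h1 z))%C by ring.
      rewrite <- Eh1; ring.
Qed.

(** Dividing out the root [w n] keeps both the leading coefficient and the other roots. The
    candidate roots are one injective sequence, so that the induction can reuse it unchanged. *)
Lemma pol_roots n : forall g l (w : nat -> C),
  (forall i j, w i = w j -> i = j) -> pol n g l ->
  (forall i, (i <= n)%nat -> g (w i) = 0%C) -> l = 0%C.
Proof.
  induction n as [|n IH]; intros g l w Hw Hg Hr.
  - rewrite <- (Hr 0%nat) by lia. symmetry; apply Hg.
  - destruct (pol_factor n g l (w (S n)) Hg) as (h & Hh & Eh).
    apply (IH h l w Hw Hh). intros i Hi.
    specialize (Eh (w i)). rewrite !Hr in Eh by lia.
    destruct (Ceq_dec (h (w i)) 0%C) as [E|N]; [exact E|exfalso].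
    assert (D : (w i - w (S n))%C <> 0%C).
    { intros D. assert (w i = w (S n)).
      { replace (w i) with ((w i - w (S n)) + w (S n))%C by ring. rewrite D; ring. }
      apply Hw in H; lia. }
    apply (Cmult_neq_0 _ _ D N). rewrite <- Eh; ring.
Qed.

(** * Polynomials in the complex exponential *)

Definition cis (t : R) : C := (cos t, sin t).

(* [f t = l e^(i n t) + (terms in e^(i k t) with -n <= k < n)]. *)
Definition trigpol (n : nat) (f : R -> C) (l : C) : Prop :=
  exists g, pol (n + n) g l /\ forall t, (f t * cis t ^ n)%C = g (cis t).

Lemma trigpol_plus n f g a b :
  trigpol n f a -> trigpol n g b -> trigpol n (fun t => f t + g t)%C (a + b)%C.
Proof.
  intros (f1 & Hf & Ef) (g1 & Hg & Eg).
  exists (fun z => f1 z + g1 z)%C; split; [apply pol_plus; assumption|].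
  intros t; rewrite <- Ef, <- Eg; ring.
Qed.

Lemma trigpol_mult n m f g a b :
  trigpol n f a -> trigpol m g b -> trigpol (n + m) (fun t => f t * g t)%C (a * b)%C.
Proof.
  intros (f1 & Hf & Ef) (g1 & Hg & Eg).
  exists (fun z => f1 z * g1 z)%C; split.
  - replace (n + m + (n + m))%nat with (n + n + (m + m))%nat by lia.
    apply pol_mult; assumption.
  - intros t; rewrite <- Ef, <- Eg, Cpow_add_r; ring.
Qed.

Lemma trigpol_const k : trigpol 0 (fun _ => k) k.
Proof.
  exists (fun _ => k); split; [intros z; reflexivity|]. intros t; simpl; ring.
Qed.

Lemma trigpol_scal n f a k : trigpol n f a -> trigpol n (fun t => k * f t)%C (k * a)%C.
Proof. exact (trigpol_mult 0 n (fun _ => k) f k a (trigpol_const k)). Qed.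

Lemma trigpol_minus n f g a b :
  trigpol n f a -> trigpol n g b -> trigpol n (fun t => f t - g t)%C (a - b)%C.
Proof.
  intros (f1 & Hf & Ef) (g1 & Hg & Eg).
  exists (fun z => f1 z + -(1) * g1 z)%C; split.
  - replace (a - b)%C with (a + -(1) * b)%C by ring.
    apply pol_plus; [assumption|apply pol_scal; assumption].
  - intros t; rewrite <- Ef, <- Eg; ring.
Qed.

(** Euler's formulas: after multiplication by [e^(i t)], the coefficients from the top down are
    [(a - i b) / 2], [c] and [(a + i b) / 2]. *)
Lemma trigpol_first (c a b : C) :
  trigpol 1 (fun t => c + cos t * a + sin t * b)%C ((a - Ci * b) / 2)%C.
Proof.
  exists (fun z => z * (z * ((a - Ci * b) / 2) + c) + (a + Ci * b) / 2)%C; split.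
  - exists (fun z => z * ((a - Ci * b) / 2) + c)%C, ((a + Ci * b) / 2)%C.
    split; [|intros z; reflexivity].
    exists (fun z => (a - Ci * b) / 2)%C, c. split; intros z; reflexivity.
  - intros t. destruct a as [a1 a2], b as [b1 b2], c as [c1 c2].
    pose proof (sin2_cos2 t) as E; unfold Rsqr in E.
    unfold cis, Ci.
    apply injective_projections; simpl; field_simplify.
    + replace (cos t ^ 2) with (1 - sin t * sin t) by lra. field.
    + replace (cos t ^ 2) with (1 - sin t * sin t) by lra. field.
Qed.

Lemma trigpol_zero n (f : R -> C) (l : C) : (forall t, f t = 0%C) -> trigpol n f l -> l = 0%C.
Proof.
  intros Z (g & Hg & Eg).
  (* The angles [1 / (k + 1)] lie in [[0, PI]], where the cosine is injective, so they give
     infinitely many distinct points of the unit circle. *)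
  apply (pol_roots _ g l (fun k => cis (/ INR (S k))) ) in Hg; [exact Hg| |].
  - intros i j E. apply (f_equal fst) in E; unfold cis in E; cbn [fst] in E.
    assert (B : forall k, 0 <= / INR (S k) <= PI).
    { intros k. assert (1 <= INR (S k)) by (rewrite S_INR; pose proof (pos_INR k); lra).
      split; [left; apply Rinv_0_lt_compat; lra|].
      pose proof PI2_3_2. apply Rle_trans with 1; [|unfold PI2 in *; lra].
      rewrite <- Rinv_1. apply Rinv_le_contravar; lra. }
    apply cos_inj in E; [|apply B|apply B].
    apply Rinv_eq_reg in E. apply INR_eq in E; lia.
  - intros i _. rewrite <- Eg, Z; ring.
Qed.

(** * The leading coefficient of the minimal surface equation *)

Record trig : Type := Trig { mean : R; cosc : R; sinc : R }.

Definition tev (g : trig) (t : R) : R := mean g + cos t * cosc g + sin t * sinc g.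
Definition tdt (g : trig) : trig := Trig 0 (sinc g) (- cosc g).

Record jet : Type := Jet { j0 : trig; j1 : trig; j2 : trig }.

(* [x], [y], [z] are the coordinates of a family of circles as functions of [t],
   with their first two derivatives in the parameter [s] of the family; [(A, B, 1)]
   is normal to the surface, so that [(A, B)] has zero divergence. *)
Definition minimal_jet (x y z : jet) : Prop :=
  forall t : R, exists A B As At Bs Bt : R,
    let xt := tev (tdt (j0 x)) t in let xs := tev (j1 x) t in
    let yt := tev (tdt (j0 y)) t in let ys := tev (j1 y) t in
    let zt := tev (tdt (j0 z)) t in let zs := tev (j1 z) t in
    let xtt := tev (tdt (tdt (j0 x))) t in let xst := tev (tdt (j1 x)) t in
    let ytt := tev (tdt (tdt (j0 y))) t in let yst := tev (tdt (j1 y)) t in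
    let ztt := tev (tdt (tdt (j0 z))) t in let zst := tev (tdt (j1 z)) t in
    let xss := tev (j2 x) t in let yss := tev (j2 y) t in let zss := tev (j2 z) t in
    A * xs + B * ys + zs = 0 /\ A * xt + B * yt + zt = 0 /\
    As * xs + A * xss + (Bs * ys + B * yss) + zss = 0 /\
    At * xs + A * xst + (Bt * ys + B * yst) + zst = 0 /\
    As * xt + A * xst + (Bs * yt + B * yst) + zst = 0 /\
    At * xt + A * xtt + (Bt * yt + B * ytt) + ztt = 0 /\
    As * yt - At * ys + xs * Bt - xt * Bs = 0 /\
    xs * yt - xt * ys <> 0.

(** The coefficient of [e^(i t)] in [tev g t]. Over the three coordinates of a circle it gives the
    vector [V / 2]. *)
Definition lead (g : trig) : C := (cosc g / 2, - sinc g / 2).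

Lemma trigpol_tev g : trigpol 1 (fun t => RtoC (tev g t)) (lead g).
Proof.
  pose proof (trigpol_first (mean g) (cosc g) (sinc g)) as (h & Hh & Eh).
  exists h; split.
  - replace (lead g) with ((cosc g - Ci * sinc g) / 2)%C; [exact Hh|].
    unfold lead, Ci; apply injective_projections; simpl; field.
  - intros t; rewrite <- Eh; f_equal.
    unfold tev; apply injective_projections; simpl; ring.
Qed.

Lemma lead_tdt g : lead (tdt g) = (Ci * lead g)%C.
Proof. unfold lead, Ci; apply injective_projections; simpl; field. Qed.

Lemma trigpol_complex x y :
  trigpol 1 (fun t => RtoC (tev x t) + Ci * RtoC (tev y t))%C (lead x + Ci * lead y)%C.
Proof.
  apply trigpol_plus; [apply trigpol_tev|].
  apply (trigpol_scal 1), trigpol_tev.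
Qed.

Lemma trigpol_complex_conj x y :
  trigpol 1 (fun t => RtoC (tev x t) - Ci * RtoC (tev y t))%C (lead x - Ci * lead y)%C.
Proof.
  apply trigpol_minus; [apply trigpol_tev|].
  apply (trigpol_scal 1), trigpol_tev.
Qed.

(** * The holomorphy equation and its top coefficient *)

Definition det3 (u1 u2 u3 v1 v2 v3 w1 w2 w3 : C) : C :=
  (u1 * (v2 * w3 - v3 * w2) - u2 * (v1 * w3 - v3 * w1) + u3 * (v1 * w2 - v2 * w1))%C.

(* [f = u_x - i u_y] is a holomorphic function of [p = x + i y], that is
   [f_s p_t = f_t p_s]; with [q = x - i y] one has [f = M / D] for
   [M = 2 (z_t q_s - z_s q_t)] and [D = p_t q_s - p_s q_t].  Here [w = 2 z]. *)
Definition holomorphy_defect (pt ps ptt pst pss qt qs qtt qst qss wt ws wtt wst wss : C) : C :=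
  let M := (wt * qs - ws * qt)%C in
  let Ms := (wst * qs + wt * qss - (wss * qt + ws * qst))%C in
  let Mt := (wtt * qs + wt * qst - (wst * qt + ws * qtt))%C in
  let D := (pt * qs - ps * qt)%C in
  let Ds := (pst * qs + pt * qss - (pss * qt + ps * qst))%C in
  let Dt := (ptt * qs + pt * qst - (pst * qt + ps * qtt))%C in
  ((Ms * D - M * Ds) * pt - (Mt * D - M * Dt) * ps)%C.

(** The chain rule gives [M = f D], where [fb] has cancelled; the product rule gives [M_s] and
    [M_t], each with its own expansion of [w_st]. The defect is then [D^2 (f_s p_t - f_t p_s)]. *)
Lemma holomorphy_defect_zero
  (f fb fs fbs ft fbt pt ps ptt pst pss qt qs qtt qst qss wt ws wtt wst wss : C) :
  wt = (f * pt + fb * qt)%C -> ws = (f * ps + fb * qs)%C ->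
  wst = (fs * pt + f * pst + (fbs * qt + fb * qst))%C ->
  wss = (fs * ps + f * pss + (fbs * qs + fb * qss))%C ->
  wtt = (ft * pt + f * ptt + (fbt * qt + fb * qtt))%C ->
  wst = (ft * ps + f * pst + (fbt * qs + fb * qst))%C ->
  (fs * pt = ft * ps)%C ->
  holomorphy_defect pt ps ptt pst pss qt qs qtt qst qss wt ws wtt wst wss = 0%C.
Proof.
  intros E1 E2 E3 E4 E5 E6 E7.
  unfold holomorphy_defect.
  set (D := (pt * qs - ps * qt)%C).
  set (Ds := (pst * qs + pt * qss - (pss * qt + ps * qst))%C).
  set (Dt := (ptt * qs + pt * qst - (pst * qt + ps * qtt))%C).
  assert (HM : (wt * qs - ws * qt)%C = (f * D)%C).
  { unfold D; rewrite E1, E2; ring. }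
  assert (HMs : (wst * qs + wt * qss - (wss * qt + ws * qst))%C = (fs * D + f * Ds)%C).
  { unfold D, Ds; rewrite E1, E2, E3, E4; ring. }
  assert (HMt : (wtt * qs + wt * qst - (wst * qt + ws * qtt))%C = (ft * D + f * Dt)%C).
  { unfold D, Dt; rewrite E1, E2, E5, E6; ring. }
  rewrite HM, HMs, HMt.
  transitivity (D * D * (fs * pt - ft * ps))%C; [ring|].
  rewrite E7; ring.
Qed.

(** The defect is a ring expression, so its top coefficient is the same expression in the top
    coefficients. The degree is 2 for [M] and [D], 4 for the differences of products such as
    [Ms * D - M * Ds], and 5 after the last factor. *)
Lemma trigpol_holomorphy_defect
  (pt ps ptt pst pss qt qs qtt qst qss wt ws wtt wst wss : R -> C)
  (pt' ps' ptt' pst' pss' qt' qs' qtt' qst' qss' wt' ws' wtt' wst' wss' : C) :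
  trigpol 1 pt pt' -> trigpol 1 ps ps' -> trigpol 1 ptt ptt' -> trigpol 1 pst pst' ->
  trigpol 1 pss pss' -> trigpol 1 qt qt' -> trigpol 1 qs qs' -> trigpol 1 qtt qtt' ->
  trigpol 1 qst qst' -> trigpol 1 qss qss' -> trigpol 1 wt wt' -> trigpol 1 ws ws' ->
  trigpol 1 wtt wtt' -> trigpol 1 wst wst' -> trigpol 1 wss wss' ->
  trigpol 5
    (fun t => holomorphy_defect (pt t) (ps t) (ptt t) (pst t) (pss t) (qt t) (qs t) (qtt t)
       (qst t) (qss t) (wt t) (ws t) (wtt t) (wst t) (wss t))
    (holomorphy_defect pt' ps' ptt' pst' pss' qt' qs' qtt' qst' qss' wt' ws' wtt' wst' wss').
Proof.
  intros. unfold holomorphy_defect.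
  apply (trigpol_minus 5); apply (trigpol_mult 4 1); try assumption;
    apply (trigpol_minus 4); apply (trigpol_mult 2 2);
    repeat first [ apply (trigpol_minus 2) | apply (trigpol_plus 2)
                 | apply (trigpol_mult 1 1); assumption ].
Qed.

(** With [d/dt] replaced by [i], the defect of the leading coefficients is 4 times this product. For
    an isotropic vector the first factor is minus the square of the third component, whence the
    [V_z^2] of the overview. *)
Lemma leading_coefficient (x y z : jet) :
  minimal_jet x y z ->
  ((lead (j0 x) * lead (j0 x) + lead (j0 y) * lead (j0 y)) *
   det3 (lead (j0 x)) (lead (j0 y)) (lead (j0 z))
        (lead (j1 x)) (lead (j1 y)) (lead (j1 z))
        (lead (j2 x)) (lead (j2 y)) (lead (j2 z)) = 0)%C.
Proof.
  intros H.
  pose (p := fun (a b : trig) t => (RtoC (tev a t) + Ci * RtoC (tev b t))%C).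
  pose (q := fun (a b : trig) t => (RtoC (tev a t) - Ci * RtoC (tev b t))%C).
  pose (w := fun (a : trig) t => (2 * RtoC (tev a t))%C).
  assert (Tp : forall a b, trigpol 1 (p a b) (lead a + Ci * lead b)%C)
    by exact trigpol_complex.
  assert (Tq : forall a b, trigpol 1 (q a b) (lead a - Ci * lead b)%C)
    by exact trigpol_complex_conj.
  assert (Tw : forall a, trigpol 1 (w a) (2 * lead a)%C)
    by (intros a; apply (trigpol_scal 1), trigpol_tev).
  destruct x as [x0 x1 x2], y as [y0 y1 y2], z as [z0 z1 z2]; unfold minimal_jet in H;
    cbn [j0 j1 j2] in *.
  assert (E : holomorphy_defect
     (lead (tdt x0) + Ci * lead (tdt y0)) (lead x1 + Ci * lead y1)
     (lead (tdt (tdt x0)) + Ci * lead (tdt (tdt y0))) 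
     (lead (tdt x1) + Ci * lead (tdt y1)) (lead x2 + Ci * lead y2)
     (lead (tdt x0) - Ci * lead (tdt y0)) (lead x1 - Ci * lead y1)
     (lead (tdt (tdt x0)) - Ci * lead (tdt (tdt y0))) 
     (lead (tdt x1) - Ci * lead (tdt y1)) (lead x2 - Ci * lead y2)
     (2 * lead (tdt z0)) (2 * lead z1) (2 * lead (tdt (tdt z0))) 
     (2 * lead (tdt z1)) (2 * lead z2) = 0%C).
  { eapply trigpol_zero; [|apply trigpol_holomorphy_defect;
      [apply Tp|apply Tp|apply Tp|apply Tp|apply Tp|apply Tq|apply Tq|apply Tq|apply Tq
      |apply Tq|apply Tw|apply Tw|apply Tw|apply Tw|apply Tw]].
    intros t.
    destruct (H t) as (A & B & As & At & Bs & Bt & H1 & H2 & H3 & H4 & H5 & H6 & H7 & _).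
    (* Since [(A, B, 1)] is normal, [z_x = - A] and [z_y = - B]. The real part of
       [f_s p_t = f_t p_s] is the agreement of the two expressions of [z_st]; the imaginary part is
       the zero divergence. *)
    apply holomorphy_defect_zero with
      (f := (- A, B)) (fb := (- A, - B)) (fs := (- As, Bs)) (fbs := (- As, - Bs))
      (ft := (- At, Bt)) (fbt := (- At, - Bt));
      unfold p, q, w, Ci; apply injective_projections; cbn -[tev tdt]; lra. }
  rewrite !lead_tdt in E.
  assert (I : (Ci * Ci)%C = (-(1))%C) by (unfold Ci; apply injective_projections; simpl; ring).
  revert E; generalize (lead x0) (lead x1) (lead x2) (lead y0) (lead y1) (lead y2)
    (lead z0) (lead z1) (lead z2); intros X0 X1 X2 Y0 Y1 Y2 Z0 Z1 Z2 E.
  assert (F : (4 * ((X0 * X0 + Y0 * Y0) * det3 X0 Y0 Z0 X1 Y1 Z1 X2 Y2 Z2))%C = 0%C).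
  { rewrite <- E. unfold det3, holomorphy_defect. ring [I]. }
  destruct (Ceq_dec ((X0 * X0 + Y0 * Y0) * det3 X0 Y0 Z0 X1 Y1 Z1 X2 Y2 Z2)%C 0%C) as [G|G];
    [exact G|exfalso].
  apply Cmult_neq_0 with (2 := G) (3 := F).
  intros K; apply (f_equal fst) in K; simpl in K; lra.
Qed.

(** * Isotropy of the complex vector of a circle *)

Definition cosv (x y z : trig) : V3 := (cosc x, cosc y, cosc z).
Definition sinv (x y z : trig) : V3 := (sinc x, sinc y, sinc z).

(** For [V = a - i b] these are the real and imaginary parts of [V.V = 0] and of its first two
    derivatives. *)
Definition circular_jet (x y z : jet) : Prop :=
  let a := cosv (j0 x) (j0 y) (j0 z) in let b := sinv (j0 x) (j0 y) (j0 z) in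
  let a' := cosv (j1 x) (j1 y) (j1 z) in let b' := sinv (j1 x) (j1 y) (j1 z) in
  let a'' := cosv (j2 x) (j2 y) (j2 z) in let b'' := sinv (j2 x) (j2 y) (j2 z) in
  0 < dot a a /\
  dot a a = dot b b /\ dot a b = 0 /\
  dot a a' = dot b b' /\ dot a b' + dot a' b = 0 /\
  dot a' a' + dot a a'' = dot b' b' + dot b b'' /\
  dot a b'' + 2 * dot a' b' + dot a'' b = 0.

(* With [V = (a - i b) / 2], the relations [V.V = 0], [V.V' = 0] and
   [V'.V' + V.V'' = 0] make the Gram determinant of [V, V', V''] equal to
   [- (V'.V')^3]. *)
Lemma isotropic_det3 (u1 u2 u3 v1 v2 v3 w1 w2 w3 : C) :
  (u1 * u1 + u2 * u2 + u3 * u3 = 0)%C ->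
  (u1 * v1 + u2 * v2 + u3 * v3 = 0)%C ->
  (v1 * v1 + v2 * v2 + v3 * v3 + (u1 * w1 + u2 * w2 + u3 * w3) = 0)%C ->
  ((u1 * u1 + u2 * u2) * det3 u1 u2 u3 v1 v2 v3 w1 w2 w3 = 0)%C ->
  u3 = 0%C \/ (v1 * v1 + v2 * v2 + v3 * v3 = 0)%C.
Proof.
  intros H0 H1 H2 H3.
  set (h := (v1 * v1 + v2 * v2 + v3 * v3)%C) in *.
  destruct (Ceq_dec u3 0%C) as [E|E]; [left; exact E|right].
  destruct (Ceq_dec h 0%C) as [F|F]; [exact F|exfalso].
  (* By isotropy [u1^2 + u2^2 = - u3^2], which is nonzero here, so the determinant itself
     vanishes. *)
  assert (D : det3 u1 u2 u3 v1 v2 v3 w1 w2 w3 = 0%C).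
  { destruct (Ceq_dec (det3 u1 u2 u3 v1 v2 v3 w1 w2 w3) 0%C) as [G|G]; [exact G|exfalso].
    apply (Cmult_neq_0 (u3 * u3) _ (Cmult_neq_0 _ _ E E) G).
    transitivity ((u1 * u1 + u2 * u2 + u3 * u3) * det3 u1 u2 u3 v1 v2 v3 w1 w2 w3
                  - (u1 * u1 + u2 * u2) * det3 u1 u2 u3 v1 v2 v3 w1 w2 w3)%C; [ring|].
    rewrite H0, H3; ring. }
  apply (Cmult_neq_0 _ _ F (Cmult_neq_0 _ _ F F)).
  assert (G : (u1 * w1 + u2 * w2 + u3 * w3 = - h)%C).
  { transitivity ((h + (u1 * w1 + u2 * w2 + u3 * w3)) - h)%C; [ring|]. rewrite H2; ring. }
  set (vw := (v1 * w1 + v2 * w2 + v3 * w3)%C).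
  set (ww := (w1 * w1 + w2 * w2 + w3 * w3)%C).
  assert (Gram : (det3 u1 u2 u3 v1 v2 v3 w1 w2 w3 * det3 u1 u2 u3 v1 v2 v3 w1 w2 w3 =
    det3 (u1 * u1 + u2 * u2 + u3 * u3) (u1 * v1 + u2 * v2 + u3 * v3)
         (u1 * w1 + u2 * w2 + u3 * w3)
         (u1 * v1 + u2 * v2 + u3 * v3) h vw
         (u1 * w1 + u2 * w2 + u3 * w3) vw ww)%C).
  { unfold det3, h, vw, ww; ring. }
  rewrite H0, H1, G, D in Gram. unfold det3 in Gram.
  transitivity (-((0 * (h * ww - vw * vw) - 0 * (0 * ww - vw * - h) +
         - h * (0 * vw - h * - h))))%C; [ring|]. rewrite <- Gram; ring.
Qed.

Lemma minimal_circles_alternative (x y z : jet) :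
  minimal_jet x y z -> circular_jet x y z ->
  let a := cosv (j0 x) (j0 y) (j0 z) in let b := sinv (j0 x) (j0 y) (j0 z) in
  let a' := cosv (j1 x) (j1 y) (j1 z) in let b' := sinv (j1 x) (j1 y) (j1 z) in
  (zc a = 0 /\ zc b = 0) \/
  (dot a' a' = dot b' b' /\ dot a' b' = 0 /\
   dot (cross a b) a' = 0 /\ dot (cross a b) b' = 0).
Proof.
  intros H%leading_coefficient (H0 & H1 & H2 & H3 & H4 & H5 & H6).
  destruct x as [[xm xa xb] [xm1 xa1 xb1] [xm2 xa2 xb2]].
  destruct y as [[ym ya yb] [ym1 ya1 yb1] [ym2 ya2 yb2]].
  destruct z as [[zm za zb] [zm1 za1 zb1] [zm2 za2 zb2]].
  unfold cosv, sinv, dot, cross, xc, yc, zc in *; cbn [fst snd j0 j1 j2 cosc sinc] in *.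
  edestruct isotropic_det3 as [E|E]; [| | |exact H| |].
  - unfold lead; apply injective_projections; simpl; lra.
  - unfold lead; apply injective_projections; simpl; lra.
  - unfold lead; apply injective_projections; simpl; lra.
  - left. unfold lead in E; cbn [cosc sinc] in E. injection E; intros; split; lra.
  - right. unfold lead in E; cbn [cosc sinc] in E.
    pose proof (f_equal fst E) as E1; pose proof (f_equal snd E) as E2; simpl in E1, E2.
    assert (E3 : xa1 * xa1 + ya1 * ya1 + za1 * za1 = xb1 * xb1 + yb1 * yb1 + zb1 * zb1) by lra.
    assert (E4 : xa1 * xb1 + ya1 * yb1 + za1 * zb1 = 0) by lra.
    clear H E E1 E2 H5 H6. split; [exact E3|split; [exact E4|]].
    set (na := (ya * zb - za * yb) * xa1 + (za * xb - xa * zb) * ya1 + (xa * yb - ya * xb) * za1).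
    set (nb := (ya * zb - za * yb) * xb1 + (za * xb - xa * zb) * yb1 + (xa * yb - ya * xb) * zb1).
    set (r := xa * xa + ya * ya + za * za) in *.
    set (aa := xa * xa1 + ya * ya1 + za * za1) in *.
    set (bb := xb * xb1 + yb * yb1 + zb * zb1) in *.
    set (ab := xa * xb1 + ya * yb1 + za * zb1) in *.
    set (ba := xa1 * xb + ya1 * yb + za1 * zb) in *.
    set (A := xa1 * xa1 + ya1 * ya1 + za1 * za1) in *.
    set (B := xb1 * xb1 + yb1 * yb1 + zb1 * zb1) in *.
    set (AB := xa1 * xb1 + ya1 * yb1 + za1 * zb1) in *.
    set (s := xb * xb + yb * yb + zb * zb) in *.
    set (o := xa * xb + ya * yb + za * zb) in *.
    (* The squares and the product of the triple products [na = (a x b).a'] and [nb = (a x b).b']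
       are Gram determinants. The circle relations and [V'.V' = 0] reduce them to [na^2 = nb^2] and
       [na nb = 0], so both vanish. *)
    assert (P : na * na = r * (s * A - ba * ba) - o * (o * A - ba * aa) + aa * (o * ba - s * aa))
      by (unfold na, r, s, A, ba, o, aa; ring).
    assert (Q : nb * nb = r * (s * B - bb * bb) - o * (o * B - bb * ab) + ab * (o * bb - s * ab))
      by (unfold nb, r, s, B, bb, o, ab; ring).
    assert (T : na * nb = r * (s * AB - ba * bb) - o * (o * AB - ba * ab)
                          + aa * (o * bb - s * ab))
      by (unfold na, nb, r, s, AB, ba, bb, o, aa, ab; ring).
    replace ba with (- ab) in * by lra.
    rewrite <- H1, H2 in *. rewrite <- H3 in *. rewrite E4 in T. rewrite <- E3 in Q.
    assert (T' : na * nb = 0) by (rewrite T; ring).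
    assert (S : na * na = nb * nb) by (rewrite P, Q; ring).
    apply Rmult_integral in T'. destruct T' as [T'|T']; rewrite T' in S; split; nra.
Qed.

(** * Circles in parallel tilted planes *)

Lemma linear_trig_root (A B : R) : exists t, A * cos t + B * sin t = 0.
Proof.
  destruct (Req_dec B 0) as [E|E].
  - exists (PI / 2). rewrite E, cos_PI2; ring.
  - exists (atan (- A / B)).
    assert (H : tan (atan (- A / B)) = - A / B) by apply tan_atan.
    assert (P : 0 < cos (atan (- A / B))).
    { pose proof (atan_bound (- A / B)). apply cos_gt_0; lra. }
    unfold tan in H.
    replace (sin (atan (- A / B))) with (- A / B * cos (atan (- A / B))).
    + field; exact E.
    + rewrite <- H at 1. field; lra.
Qed.

(** [(al, be)] is minus the horizontal gradient of a function that is constant on each circle, with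
    derivative [d1] in [s]. Cramer's rule expresses this gradient and its derivatives through the
    positions; substituting them in the divergence equation and clearing the powers of [J] leaves
    the conclusion. *)
Lemma reduced_minimal_equation
  (al be als alt bes bet xs xt ys yt xss xst xtt yss yst ytt d1 d2 : R) :
  let J := xs * yt - xt * ys in
  let Js := xss * yt + xs * yst - xst * ys - xt * yss in
  let Jt := xst * yt + xs * ytt - xtt * ys - xt * yst in
  al * xs + be * ys + d1 = 0 -> al * xt + be * yt = 0 ->
  als * xs + al * xss + (bes * ys + be * yss) + d2 = 0 ->
  alt * xs + al * xst + (bet * ys + be * yst) = 0 ->
  als * xt + al * xst + (bes * yt + be * yst) = 0 ->
  alt * xt + al * xtt + (bet * yt + be * ytt) = 0 ->
  als * yt - alt * ys + xs * bet - xt * bes = 0 ->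
  (d2 * J - d1 * Js) * (xt * xt + yt * yt) + d1 * Jt * (xt * xs + yt * ys)
  + d1 * J * (xst * xt + yst * yt) - d1 * J * (xtt * xs + ytt * ys) = 0.
Proof.
  intros J Js Jt H1 H2 H3 H4 H5 H6 H7.
  assert (Ja : J * al = - d1 * yt).
  { unfold J. replace d1 with (- (al * xs + be * ys)) by lra.
    transitivity (al * xs * yt + be * ys * yt - ys * (al * xt + be * yt)); [ring|].
    rewrite H2; ring. }
  assert (Jb : J * be = d1 * xt).
  { unfold J. replace d1 with (- (al * xs + be * ys)) by lra.
    transitivity (- (al * xs + be * ys) * xt + xs * (al * xt + be * yt)); [ring|].
    rewrite H2; ring. }
  (* Right-hand sides of the linear systems for the derivatives of [(al, be)]; the two mixed
     equations share [r2]. *)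
  set (r1 := - d2 - al * xss - be * yss). set (r2 := - al * xst - be * yst).
  set (q2 := - al * xtt - be * ytt).
  assert (Js1 : J * als = r1 * yt - r2 * ys).
  { replace r1 with (als * xs + bes * ys) by (unfold r1; lra).
    replace r2 with (als * xt + bes * yt) by (unfold r2; lra). unfold J; ring. }
  assert (Js2 : J * bes = xs * r2 - xt * r1).
  { replace r1 with (als * xs + bes * ys) by (unfold r1; lra).
    replace r2 with (als * xt + bes * yt) by (unfold r2; lra). unfold J; ring. }
  assert (Jt1 : J * alt = r2 * yt - q2 * ys).
  { replace r2 with (alt * xs + bet * ys) by (unfold r2; lra).
    replace q2 with (alt * xt + bet * yt) by (unfold q2; lra). unfold J; ring. }
  assert (Jt2 : J * bet = xs * q2 - xt * r2).
  { replace r2 with (alt * xs + bet * ys) by (unfold r2; lra).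
    replace q2 with (alt * xt + bet * yt) by (unfold q2; lra). unfold J; ring. }
  assert (R1 : J * r1 = - d2 * J + d1 * yt * xss - d1 * xt * yss).
  { unfold r1. transitivity (- d2 * J - J * al * xss - J * be * yss); [ring|].
    rewrite Ja, Jb; ring. }
  assert (R2 : J * r2 = d1 * yt * xst - d1 * xt * yst).
  { unfold r2. transitivity (- (J * al) * xst - J * be * yst); [ring|].
    rewrite Ja, Jb; ring. }
  assert (Q2 : J * q2 = d1 * yt * xtt - d1 * xt * ytt).
  { unfold q2. transitivity (- (J * al) * xtt - J * be * ytt); [ring|].
    rewrite Ja, Jb; ring. }
  assert (E : J * (J * (als * yt - alt * ys + xs * bet - xt * bes)) = 0)
    by (rewrite H7; ring).
  assert (E' : (J * r1) * (xt * xt + yt * yt) - 2 * (J * r2) * (xt * xs + yt * ys)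
               + (J * q2) * (xs * xs + ys * ys) = 0).
  { rewrite <- E.
    transitivity (J * ((J * als) * yt - (J * alt) * ys + xs * (J * bet) - xt * (J * bes)));
      [|ring].
    rewrite Js1, Js2, Jt1, Jt2; ring. }
  rewrite R1, R2, Q2 in E'. rewrite <- Ropp_0, <- E'. unfold Js, Jt, J. ring.
Qed.

(* Adding the equation at the antipodal point kills the terms that are odd in
   the point of the circle. *)
Lemma reduced_equation_even_part (P Q P2 Q2 u v w z l1 l2 s t d1 d2 : R) :
  let F := fun u v w z : R =>
    let xt := w in let yt := z in let xtt := - u in let ytt := - v in
    let xs := P + l1 * u + l2 * w in let ys := Q + l1 * v + l2 * z in
    let xst := l1 * w - l2 * u in let yst := l1 * z - l2 * v in
    let xss := P2 + s * u + t * w in let yss := Q2 + s * v + t * z in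
    let J := xs * yt - xt * ys in
    let Js := xss * yt + xs * yst - xst * ys - xt * yss in
    let Jt := xst * yt + xs * ytt - xtt * ys - xt * yst in
    (d2 * J - d1 * Js) * (xt * xt + yt * yt) + d1 * Jt * (xt * xs + yt * ys)
    + d1 * J * (xst * xt + yst * yt) - d1 * J * (xtt * xs + ytt * ys) in
  F u v w z = 0 -> F (- u) (- v) (- w) (- z) = 0 ->
  (u * z - v * w) *
  ((d2 * l1 - d1 * (s + l2 * l2)) * (w * w + z * z)
   + d1 * (P * P + Q * Q + l1 * l1 * (u * u + v * v))) = 0.
Proof.
  intros F E1 E2.
  transitivity ((F u v w z + F (- u) (- v) (- w) (- z)) / 2); [unfold F; field|].
  rewrite E1, E2; field.
Qed.

(** What remains of [v] after projection on [a] and [b] is orthogonal to [a], [b] and [n]. Their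
    determinant [D] is nonzero because [D^2] is their Gram determinant, so Cramer's rule makes the
    remainder zero. *)
Lemma orthogonal_span (a b n v : V3) :
  0 < dot a a -> dot a a = dot b b -> dot a b = 0 -> 0 < dot n n ->
  dot n a = 0 -> dot n b = 0 -> dot n v = 0 ->
  let l := dot a v / dot a a in let m := dot b v / dot a a in
  xc v = l * xc a + m * xc b /\ yc v = l * yc a + m * yc b /\ zc v = l * zc a + m * zc b.
Proof.
  intros Ha Hab Ho Hn Na Nb Nv l m.
  assert (La : l * dot a a = dot a v) by (unfold l; field; lra).
  assert (Lb : m * dot a a = dot b v) by (unfold m; field; lra).
  clearbody l m.
  destruct a as [[a1 a2] a3], b as [[b1 b2] b3], n as [[n1 n2] n3], v as [[v1 v2] v3].
  unfold dot, xc, yc, zc in *; cbn [fst snd] in *.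
  set (w1 := v1 - (l * a1 + m * b1)). set (w2 := v2 - (l * a2 + m * b2)).
  set (w3 := v3 - (l * a3 + m * b3)).
  assert (W1 : a1 * w1 + a2 * w2 + a3 * w3 = 0).
  { unfold w1, w2, w3.
    transitivity ((a1 * v1 + a2 * v2 + a3 * v3) - l * (a1 * a1 + a2 * a2 + a3 * a3)
                  - m * (a1 * b1 + a2 * b2 + a3 * b3)); [ring|].
    rewrite La, Ho; ring. }
  assert (W2 : b1 * w1 + b2 * w2 + b3 * w3 = 0).
  { unfold w1, w2, w3.
    transitivity ((b1 * v1 + b2 * v2 + b3 * v3) - m * (b1 * b1 + b2 * b2 + b3 * b3)
                  - l * (a1 * b1 + a2 * b2 + a3 * b3)); [ring|].
    rewrite <- Hab, Lb, Ho; ring. }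
  assert (W3 : n1 * w1 + n2 * w2 + n3 * w3 = 0).
  { unfold w1, w2, w3.
    transitivity ((n1 * v1 + n2 * v2 + n3 * v3) - l * (n1 * a1 + n2 * a2 + n3 * a3)
                  - m * (n1 * b1 + n2 * b2 + n3 * b3)); [ring|].
    rewrite Nv, Na, Nb; ring. }
  set (D := n1 * (a2 * b3 - a3 * b2) + n2 * (a3 * b1 - a1 * b3) + n3 * (a1 * b2 - a2 * b1)).
  assert (HD : D <> 0).
  { intros HD.
    assert (G : D * D = (n1 * n1 + n2 * n2 + n3 * n3) *
       ((a1 * a1 + a2 * a2 + a3 * a3) * (b1 * b1 + b2 * b2 + b3 * b3)
        - (a1 * b1 + a2 * b2 + a3 * b3) * (a1 * b1 + a2 * b2 + a3 * b3))
       - (n1 * a1 + n2 * a2 + n3 * a3) * ((n1 * a1 + n2 * a2 + n3 * a3) * (b1 * b1 + b2 * b2 + b3 * b3)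
             - (n1 * b1 + n2 * b2 + n3 * b3) * (a1 * b1 + a2 * b2 + a3 * b3))
       + (n1 * b1 + n2 * b2 + n3 * b3) * ((n1 * a1 + n2 * a2 + n3 * a3) * (a1 * b1 + a2 * b2 + a3 * b3)
             - (n1 * b1 + n2 * b2 + n3 * b3) * (a1 * a1 + a2 * a2 + a3 * a3)))
      by (unfold D; ring).
    rewrite HD, Ho, Na, Nb, <- Hab in G.
    assert (0 < (n1 * n1 + n2 * n2 + n3 * n3) *
       ((a1 * a1 + a2 * a2 + a3 * a3) * (a1 * a1 + a2 * a2 + a3 * a3)))
      by (repeat apply Rmult_lt_0_compat; assumption).
    lra. }
  assert (K : w1 = 0 /\ w2 = 0 /\ w3 = 0).
  { repeat split; apply Rmult_eq_reg_l with D; try exact HD; rewrite Rmult_0_r.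
    - transitivity ((n1 * w1 + n2 * w2 + n3 * w3) * (a2 * b3 - a3 * b2)
        + (a1 * w1 + a2 * w2 + a3 * w3) * (b2 * n3 - b3 * n2)
        + (b1 * w1 + b2 * w2 + b3 * w3) * (n2 * a3 - n3 * a2)); [unfold D; ring|].
      rewrite W1, W2, W3; ring.
    - transitivity ((n1 * w1 + n2 * w2 + n3 * w3) * (a3 * b1 - a1 * b3)
        + (a1 * w1 + a2 * w2 + a3 * w3) * (b3 * n1 - b1 * n3)
        + (b1 * w1 + b2 * w2 + b3 * w3) * (n3 * a1 - n1 * a3)); [unfold D; ring|].
      rewrite W1, W2, W3; ring.
    - transitivity ((n1 * w1 + n2 * w2 + n3 * w3) * (a1 * b2 - a2 * b1)
        + (a1 * w1 + a2 * w2 + a3 * w3) * (b1 * n2 - b2 * n1)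
        + (b1 * w1 + b2 * w2 + b3 * w3) * (n1 * a2 - n2 * a1)); [unfold D; ring|].
      rewrite W1, W2, W3; ring. }
  unfold w1, w2, w3 in K; lra.
Qed.

(** A circle in a vertical plane projects to a horizontal segment; at an endpoint of the segment the
    projected velocity vanishes, and the Jacobian with it. *)
Lemma minimal_jet_not_vertical (x y z : jet) (n1 n2 : R) :
  minimal_jet x y z -> 0 < n1 * n1 + n2 * n2 ->
  n1 * cosc (j0 x) + n2 * cosc (j0 y) = 0 -> n1 * sinc (j0 x) + n2 * sinc (j0 y) = 0 ->
  False.
Proof.
  intros H Hn Ha Hb.
  (* This form is the component of the projected velocity along [(- n2, n1)]; the component along
     [(n1, n2)] is zero for every [t]. *)
  destruct (linear_trig_root (- n2 * sinc (j0 x) + n1 * sinc (j0 y))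
             (n2 * cosc (j0 x) - n1 * cosc (j0 y))) as [t Ht].
  destruct (H t) as (A & B & As & At & Bs & Bt & _ & _ & _ & _ & _ & _ & _ & J).
  assert (E1 : tev (tdt (j0 x)) t * (n1 * n1 + n2 * n2) = 0).
  { unfold tev, tdt; cbn [mean cosc sinc].
    transitivity (n1 * ((n1 * sinc (j0 x) + n2 * sinc (j0 y)) * cos t
                     - (n1 * cosc (j0 x) + n2 * cosc (j0 y)) * sin t)
      - n2 * ((- n2 * sinc (j0 x) + n1 * sinc (j0 y)) * cos t
              + (n2 * cosc (j0 x) - n1 * cosc (j0 y)) * sin t)); [ring|].
    rewrite Ht, Ha, Hb; ring. }
  assert (E2 : tev (tdt (j0 y)) t * (n1 * n1 + n2 * n2) = 0).
  { unfold tev, tdt; cbn [mean cosc sinc].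
    transitivity (n2 * ((n1 * sinc (j0 x) + n2 * sinc (j0 y)) * cos t
                     - (n1 * cosc (j0 x) + n2 * cosc (j0 y)) * sin t)
      + n1 * ((- n2 * sinc (j0 x) + n1 * sinc (j0 y)) * cos t
              + (n2 * cosc (j0 x) - n1 * cosc (j0 y)) * sin t)); [ring|].
    rewrite Ht, Ha, Hb; ring. }
  apply Rmult_integral in E1; apply Rmult_integral in E2.
  destruct E1 as [E1|E1], E2 as [E2|E2]; try lra.
  apply J; rewrite E1, E2; ring.
Qed.

Definition meanv (x y z : trig) : V3 := (mean x, mean y, mean z).

Lemma tev_dot (n : V3) (x y z : trig) (t : R) :
  xc n * tev x t + yc n * tev y t + zc n * tev z t =
  dot n (meanv x y z) + cos t * dot n (cosv x y z) + sin t * dot n (sinv x y z).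
Proof. unfold tev, dot, meanv, cosv, sinv, xc, yc, zc; simpl; ring. Qed.

Lemma dot_tdt_mean (n : V3) (x y z : trig) : dot n (meanv (tdt x) (tdt y) (tdt z)) = 0.
Proof. unfold dot, meanv, xc, yc, zc; simpl; ring. Qed.

Lemma dot_tdt_cos (n : V3) (x y z : trig) :
  dot n (cosv (tdt x) (tdt y) (tdt z)) = dot n (sinv x y z).
Proof. reflexivity. Qed.

Lemma dot_tdt_sin (n : V3) (x y z : trig) :
  dot n (sinv (tdt x) (tdt y) (tdt z)) = - dot n (cosv x y z).
Proof. unfold dot, sinv, cosv, xc, yc, zc; simpl; ring. Qed.

Lemma sum_squares_zero (u v : R) : u * u + v * v = 0 -> u = 0 /\ v = 0.
Proof. intros E; split; nra. Qed.

(** If [n.c'] were nonzero, the averaged equation would leave two cases: either the projected circle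
    is a circle, which makes the original one horizontal, or the projected circles move only by
    turning along themselves, which makes the Jacobian zero. *)
Lemma tilted_parallel_circles (x y z : jet) (n : V3) :
  minimal_jet x y z -> circular_jet x y z ->
  let a := cosv (j0 x) (j0 y) (j0 z) in let b := sinv (j0 x) (j0 y) (j0 z) in
  let a' := cosv (j1 x) (j1 y) (j1 z) in let b' := sinv (j1 x) (j1 y) (j1 z) in
  let a'' := cosv (j2 x) (j2 y) (j2 z) in let b'' := sinv (j2 x) (j2 y) (j2 z) in
  dot a' a' = dot b' b' -> dot a' b' = 0 ->
  ~ (zc a = 0 /\ zc b = 0) -> 0 < dot n n ->
  dot n a = 0 -> dot n b = 0 -> dot n a' = 0 -> dot n b' = 0 ->
  dot n a'' = 0 -> dot n b'' = 0 ->
  dot n (meanv (j1 x) (j1 y) (j1 z)) = 0.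
Proof.
  intros H (H0 & H1 & H2 & H3 & H4 & H5 & H6) a b a' b' a'' b'' G1 G2 Hz Hn Na Nb Na1 Nb1 Na2 Nb2.
  fold a b a' b' a'' b'' in H0, H1, H2, H3, H4, H5, H6.
  set (c1 := meanv (j1 x) (j1 y) (j1 z)). set (c2 := meanv (j2 x) (j2 y) (j2 z)).
  destruct (Req_dec (dot n c1) 0) as [E|D1]; [exact E|exfalso].
  assert (Hn3 : zc n <> 0).
  { intros E. apply minimal_jet_not_vertical with (1 := H) (n1 := xc n) (n2 := yc n);
    destruct n as [[n1 n2] n3]; unfold dot, a, b, cosv, sinv, xc, yc, zc in *;
    cbn [fst snd] in *; subst n3; lra. }
  destruct (orthogonal_span a b n a' H0 H1 H2 Hn Na Nb Na1) as (Xa & Ya & _).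
  destruct (orthogonal_span a b n b' H0 H1 H2 Hn Na Nb Nb1) as (Xb & Yb & _).
  destruct (orthogonal_span a b n a'' H0 H1 H2 Hn Na Nb Na2) as (Xa2 & Ya2 & _).
  destruct (orthogonal_span a b n b'' H0 H1 H2 Hn Na Nb Nb2) as (Xb2 & Yb2 & _).
  (* The frame scales and turns in its plane: [a' = l1 a + l2 b], [b' = - l2 a + l1 b]. The same
     shape for [a''], [b''], with [s] and [r], comes from [a'.a' = b'.b'] and [a'.b' = 0]. *)
  set (l1 := dot a a' / dot a a) in *. set (l2 := dot b a' / dot a a) in *.
  set (s := dot a a'' / dot a a) in *. set (r := dot b a'' / dot a a) in *.
  assert (C : forall u v, dot u v = dot v u) by (intros; unfold dot; ring).
  replace (dot a b' / dot a a) with (- l2) in Xb, Yb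
    by (unfold l2; rewrite (C b a'); replace (dot a b') with (- dot a' b) by lra; field; lra).
  replace (dot b b' / dot a a) with l1 in Xb, Yb by (unfold l1; rewrite H3; reflexivity).
  replace (dot a b'' / dot a a) with (- r) in Xb2, Yb2
    by (unfold r; rewrite (C b a''); replace (dot a b'') with (- dot a'' b) by lra; field; lra).
  replace (dot b b'' / dot a a) with s in Xb2, Yb2
    by (unfold s; replace (dot b b'') with (dot a a'') by lra; reflexivity).
  clearbody l1 l2 s r.
  set (P := mean (j1 x)). set (Q := mean (j1 y)).
  set (P2 := mean (j2 x)). set (Q2 := mean (j2 y)).
  set (d1 := dot n c1) in *. set (d2 := dot n c2).
  set (e := d2 * l1 - d1 * (s + l2 * l2)).
  set (K := xc a * yc b - yc a * xc b).
  assert (G : forall t,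
    let u := cos t * xc a + sin t * xc b in let v := cos t * yc a + sin t * yc b in
    let w := cos t * xc b - sin t * xc a in let q := cos t * yc b - sin t * yc a in
    let xt := w in let yt := q in let xtt := - u in let ytt := - v in
    let xs := P + l1 * u + l2 * w in let ys := Q + l1 * v + l2 * q in
    let xst := l1 * w - l2 * u in let yst := l1 * q - l2 * v in
    let xss := P2 + s * u + r * w in let yss := Q2 + s * v + r * q in
    let J := xs * yt - xt * ys in
    let Js := xss * yt + xs * yst - xst * ys - xt * yss in
    let Jt := xst * yt + xs * ytt - xtt * ys - xt * yst in
    (d2 * J - d1 * Js) * (xt * xt + yt * yt) + d1 * Jt * (xt * xs + yt * ys)
    + d1 * J * (xst * xt + yst * yt) - d1 * J * (xtt * xs + ytt * ys) = 0).
  { intros t u v w q xt yt xtt ytt xs ys xst yst xss yss.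
    destruct (H t) as (A & B & As & At & Bs & Bt & E1 & E2 & E3 & E4 & E5 & E6 & E7 & _).
    pose proof (tev_dot n (tdt (j0 x)) (tdt (j0 y)) (tdt (j0 z)) t) as Zt.
    pose proof (tev_dot n (tdt (tdt (j0 x))) (tdt (tdt (j0 y))) (tdt (tdt (j0 z))) t) as Ztt.
    pose proof (tev_dot n (j1 x) (j1 y) (j1 z) t) as Zs.
    pose proof (tev_dot n (tdt (j1 x)) (tdt (j1 y)) (tdt (j1 z)) t) as Zst.
    pose proof (tev_dot n (j2 x) (j2 y) (j2 z) t) as Zss.
    rewrite !dot_tdt_mean in Zt, Ztt, Zst.
    rewrite dot_tdt_cos, dot_tdt_sin in Zt, Ztt, Zst. rewrite dot_tdt_sin, dot_tdt_cos in Ztt.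
    fold a b in Zt, Ztt. fold a' b' c1 d1 in Zs, Zst. fold a'' b'' c2 d2 in Zss.
    rewrite Na, Nb in Zt, Ztt. rewrite Na1, Nb1 in Zs, Zst. rewrite Na2, Nb2 in Zss.
    replace (tev (tdt (j0 x)) t) with xt in *
      by (unfold xt, w, tev, tdt, a, b, cosv, sinv, xc; cbn; ring).
    replace (tev (tdt (j0 y)) t) with yt in *
      by (unfold yt, q, tev, tdt, a, b, cosv, sinv, yc; cbn; ring).
    replace (tev (tdt (tdt (j0 x))) t) with xtt in *
      by (unfold xtt, u, tev, tdt, a, b, cosv, sinv, xc; cbn; ring).
    replace (tev (tdt (tdt (j0 y))) t) with ytt in *
      by (unfold ytt, v, tev, tdt, a, b, cosv, sinv, yc; cbn; ring).
    replace (tev (j1 x) t) with xs in *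
      by (unfold tev; change (cosc (j1 x)) with (xc a'); change (sinc (j1 x)) with (xc b');
          rewrite Xa, Xb; unfold xs, u, w, P; ring).
    replace (tev (j1 y) t) with ys in *
      by (unfold tev; change (cosc (j1 y)) with (yc a'); change (sinc (j1 y)) with (yc b');
          rewrite Ya, Yb; unfold ys, v, q, Q; ring).
    replace (tev (tdt (j1 x)) t) with xst in *
      by (unfold tev, tdt; cbn [mean cosc sinc];
          change (cosc (j1 x)) with (xc a'); change (sinc (j1 x)) with (xc b');
          rewrite Xa, Xb; unfold xst, u, w, P; ring).
    replace (tev (tdt (j1 y)) t) with yst in *
      by (unfold tev, tdt; cbn [mean cosc sinc];
          change (cosc (j1 y)) with (yc a'); change (sinc (j1 y)) with (yc b');
          rewrite Ya, Yb; unfold yst, v, q, Q; ring).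
    replace (tev (j2 x) t) with xss in *
      by (unfold tev; change (cosc (j2 x)) with (xc a''); change (sinc (j2 x)) with (xc b'');
          rewrite Xa2, Xb2; unfold xss, u, w, P2; ring).
    replace (tev (j2 y) t) with yss in *
      by (unfold tev; change (cosc (j2 y)) with (yc a''); change (sinc (j2 y)) with (yc b'');
          rewrite Ya2, Yb2; unfold yss, v, q, Q2; ring).
    clearbody xt yt xtt ytt xs ys xst yst xss yss.
    (* [zc n] times [(A, B)] minus [(xc n, yc n)] is minus the horizontal gradient of [n.X];
       subtracting a constant vector does not change the divergence. *)
    apply (f_equal (Rmult (zc n))) in E1, E2, E3, E4, E5, E6, E7.
    apply reduced_minimal_equation with
      (al := zc n * A - xc n) (be := zc n * B - yc n) (als := zc n * As) (bes := zc n * Bs)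
      (alt := zc n * At) (bet := zc n * Bt); lra. }
  assert (R : forall t,
    let u := cos t * xc a + sin t * xc b in let v := cos t * yc a + sin t * yc b in
    let w := cos t * xc b - sin t * xc a in let q := cos t * yc b - sin t * yc a in
    K * (e * (w * w + q * q) + d1 * (P * P + Q * Q + l1 * l1 * (u * u + v * v))) = 0).
  { intros t u v w q.
    replace K with (u * q - v * w)
      by (unfold K, u, v, w, q; pose proof (sin2_cos2 t) as S; unfold Rsqr in S;
          transitivity ((sin t * sin t + cos t * cos t) * (xc a * yc b - yc a * xc b));
          [ring|rewrite S; ring]).
    apply reduced_equation_even_part with (P2 := P2) (Q2 := Q2) (t := r).
    - specialize (G t). unfold u, v, w, q. exact G.
    - specialize (G (t + PI)). rewrite neg_cos, neg_sin in G. rewrite <- G.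
      unfold u, v, w, q. f_equal; ring. }
  (* [K] is the third component of [a x b], a vector parallel to [n], and [n] is not horizontal. *)
  assert (HK : K <> 0).
  { intros HK. clear R.
    destruct n as [[n1 n2] n3].
    unfold K, dot, a, b, cosv, sinv, xc, yc, zc in *; cbn [fst snd] in *.
    set (xa := cosc (j0 x)) in *; set (ya := cosc (j0 y)) in *; set (za := cosc (j0 z)) in *.
    set (xb := sinc (j0 x)) in *; set (yb := sinc (j0 y)) in *; set (zb := sinc (j0 z)) in *.
    clearbody xa ya za xb yb zb.
    assert (K1 : n3 * (ya * zb - za * yb) = 0).
    { transitivity (ya * (n1 * xb + n2 * yb + n3 * zb) - yb * (n1 * xa + n2 * ya + n3 * za)
                    + n1 * (xa * yb - ya * xb)); [ring|]. rewrite Na, Nb, HK; ring. }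
    assert (K2 : n3 * (xa * zb - za * xb) = 0).
    { transitivity (xa * (n1 * xb + n2 * yb + n3 * zb) - xb * (n1 * xa + n2 * ya + n3 * za)
                    - n2 * (xa * yb - ya * xb)); [ring|]. rewrite Na, Nb, HK; ring. }
    apply Rmult_integral in K1; apply Rmult_integral in K2.
    destruct K1 as [K1|K1]; [contradiction|]. destruct K2 as [K2|K2]; [contradiction|].
    assert (L : (xa * xa + ya * ya + za * za) * (xb * xb + yb * yb + zb * zb) =
      (xa * xb + ya * yb + za * zb) * (xa * xb + ya * yb + za * zb)
      + (ya * zb - za * yb) * (ya * zb - za * yb) + (xa * zb - za * xb) * (xa * zb - za * xb)
      + (xa * yb - ya * xb) * (xa * yb - ya * xb)) by ring.
    rewrite H2, K1, K2, HK, <- H1 in L.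
    pose proof (Rmult_lt_0_compat _ _ H0 H0). lra. }
  (* As a function of [t] the bracket is a combination of 1, [cos (2 t)] and [sin (2 t)], so three
     values carry all its information. *)
  pose proof (R 0) as R0. pose proof (R (PI / 2)) as R1. pose proof (R (PI / 4)) as R2.
  cbv zeta in R0, R1, R2. clear R.
  rewrite cos_0, sin_0 in R0. rewrite cos_PI2, sin_PI2 in R1.
  rewrite cos_PI4, sin_PI4 in R2.
  apply Rmult_integral in R0; destruct R0 as [R0|R0]; [contradiction|].
  apply Rmult_integral in R1; destruct R1 as [R1|R1]; [contradiction|].
  apply Rmult_integral in R2; destruct R2 as [R2|R2]; [contradiction|].
  set (k := 1 / sqrt 2) in R2.
  assert (Hk : 2 * (k * k) = 1).
  { unfold k. pose proof (sqrt_sqrt 2 ltac:(lra)).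
    assert (sqrt 2 <> 0) by (pose proof (sqrt_lt_R0 2); lra).
    transitivity (2 / (sqrt 2 * sqrt 2)); [field; assumption|]. rewrite H7; field. }
  set (A := xc a * xc a + yc a * yc a). set (B := xc b * xc b + yc b * yc b).
  set (AB := xc a * xc b + yc a * yc b).
  assert (S0 : e * B + d1 * (P * P + Q * Q + l1 * l1 * A) = 0)
    by (rewrite <- R0; unfold A, B; ring).
  assert (S1 : e * A + d1 * (P * P + Q * Q + l1 * l1 * B) = 0)
    by (rewrite <- R1; unfold A, B; ring).
  assert (S2 : e * (A + B - 2 * AB) + d1 * (2 * (P * P + Q * Q) + l1 * l1 * (A + B + 2 * AB)) = 0).
  { transitivity (2 * (e * ((k * xc b - k * xc a) * (k * xc b - k * xc a) +
       (k * yc b - k * yc a) * (k * yc b - k * yc a)) +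
       d1 * (P * P + Q * Q + l1 * l1 * ((k * xc a + k * xc b) * (k * xc a + k * xc b) +
        (k * yc a + k * yc b) * (k * yc a + k * yc b))))); [|rewrite R2; ring].
    transitivity (2 * (k * k) * e * (A + B - 2 * AB) + d1 * (2 * (P * P + Q * Q)
       + l1 * l1 * (2 * (k * k)) * (A + B + 2 * AB))); [rewrite Hk; ring|].
    unfold A, B, AB; ring. }
  (* Otherwise the differences of the three equations give [A = B] and [AB = 0]: the projection is a
     circle, and [a], [b] are horizontal. *)
  assert (He : e = d1 * (l1 * l1)).
  { destruct (Req_dec (e - d1 * (l1 * l1)) 0) as [E|E]; [lra|exfalso].
    assert (T1 : (e - d1 * (l1 * l1)) * (A - B) = 0) by lra.
    assert (T2 : (e - d1 * (l1 * l1)) * AB = 0) by lra.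
    apply Rmult_integral in T1; destruct T1 as [T1|T1]; [contradiction|].
    apply Rmult_integral in T2; destruct T2 as [T2|T2]; [contradiction|].
    apply Hz. unfold A, B in T1; unfold AB in T2; unfold dot in H1, H2.
    assert (T3 : zc a * zc b = 0) by lra.
    assert (T4 : zc a * zc a = zc b * zc b) by lra.
    apply Rmult_integral in T3; destruct T3 as [T3|T3]; rewrite T3 in T4; split; try exact T3;
      [symmetry in T4; rewrite Rmult_0_l in T4|rewrite Rmult_0_l in T4];
      apply Rmult_integral in T4; destruct T4; assumption. }
  assert (T : P * P + Q * Q + l1 * l1 * (A + B) = 0).
  { apply Rmult_eq_reg_l with d1; [|exact D1]. rewrite He in S0. lra. }
  assert (PA : 0 <= A).
  { unfold A. pose proof (Rle_0_sqr (xc a)); pose proof (Rle_0_sqr (yc a)); unfold Rsqr in *; lra. }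
  assert (PB : 0 <= B).
  { unfold B. pose proof (Rle_0_sqr (xc b)); pose proof (Rle_0_sqr (yc b)); unfold Rsqr in *; lra. }
  assert (HA : 0 < A + B).
  { destruct (Req_dec A 0) as [E|E]; [exfalso|lra].
    apply HK. unfold K. apply sum_squares_zero in E. destruct E as [-> ->]; ring. }
  assert (PL : 0 <= l1 * l1) by apply Rle_0_sqr.
  assert (PPQ : 0 <= P * P + Q * Q).
  { pose proof (Rle_0_sqr P); pose proof (Rle_0_sqr Q); unfold Rsqr in *; lra. }
  assert (PLA : 0 <= l1 * l1 * (A + B)) by (apply Rmult_le_pos; lra).
  assert (HPQ : P * P + Q * Q = 0) by lra.
  apply sum_squares_zero in HPQ; destruct HPQ as [HP HQ].
  assert (Hl : l1 * l1 * (A + B) = 0) by lra.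
  apply Rmult_integral in Hl; destruct Hl as [Hl|Hl]; [|lra].
  assert (Hl1 : l1 = 0) by (apply Rmult_integral in Hl; destruct Hl; assumption).
  (* With [P], [Q] and [l1] zero, [(x_s, y_s)] is [l2] times [(x_t, y_t)], against the nonzero
     Jacobian. *)
  destruct (H 0) as (? & ? & ? & ? & ? & ? & _ & _ & _ & _ & _ & _ & _ & J).
  apply J. unfold tev. rewrite cos_0, sin_0. unfold tdt; cbn [mean cosc sinc].
  fold P Q. rewrite HP, HQ.
  unfold a, b, a', b', cosv, sinv, xc, yc in Xa, Ya; cbn [fst snd] in Xa, Ya.
  rewrite Xa, Ya, Hl1; ring.
Qed.

(** * The minimal surface equation in terms of slopes *)

(* Unlike [differentiable_pt_lim], this form of differentiability inherits the
   calculus rules from those for functions of one variable. *)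
Definition pdiff (f : R -> R -> R) (u v fu fv : R) : Prop :=
  forall (g h : R -> R) (s g' h' : R), g s = u -> h s = v ->
    is_derive g s g' -> is_derive h s h' ->
    is_derive (fun r => f (g r) (h r)) s (fu * g' + fv * h').

Lemma pdiff_u f u v fu fv : pdiff f u v fu fv -> is_derive (fun r => f r v) u fu.
Proof.
  intros H.
  replace fu with (fu * 1 + fv * 0) by ring.
  apply (H (fun r => r) (fun _ => v) u 1 0); auto; auto_derive; auto.
Qed.

Lemma pdiff_v f u v fu fv : pdiff f u v fu fv -> is_derive (fun r => f u r) v fv.
Proof.
  intros H.
  replace fv with (fu * 0 + fv * 1) by ring.
  apply (H (fun _ => u) (fun r => r) v 0 1); auto; auto_derive; auto.
Qed.

Lemma pdiff_minus f g u v fu fv gu gv :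
  pdiff f u v fu fv -> pdiff g u v gu gv ->
  pdiff (fun u v => f u v - g u v) u v (fu - gu) (fv - gv).
Proof.
  intros F G a b s a' b' Ea Eb Ha Hb.
  replace ((fu - gu) * a' + (fv - gv) * b')
    with ((fu * a' + fv * b') - (gu * a' + gv * b')) by ring.
  apply (is_derive_minus (fun r => f (a r) (b r)) (fun r => g (a r) (b r)));
    [apply F|apply G]; assumption.
Qed.

Lemma pdiff_plus f g u v fu fv gu gv :
  pdiff f u v fu fv -> pdiff g u v gu gv ->
  pdiff (fun u v => f u v + g u v) u v (fu + gu) (fv + gv).
Proof.
  intros F G a b s a' b' Ea Eb Ha Hb.
  replace ((fu + gu) * a' + (fv + gv) * b')
    with ((fu * a' + fv * b') + (gu * a' + gv * b')) by ring.
  apply (is_derive_plus (fun r => f (a r) (b r)) (fun r => g (a r) (b r)));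
    [apply F|apply G]; assumption.
Qed.

Lemma pdiff_mult f g u v fu fv gu gv :
  pdiff f u v fu fv -> pdiff g u v gu gv ->
  pdiff (fun u v => f u v * g u v) u v (fu * g u v + f u v * gu) (fv * g u v + f u v * gv).
Proof.
  intros F G a b s a' b' Ea Eb Ha Hb. subst u v.
  replace ((fu * g (a s) (b s) + f (a s) (b s) * gu) * a'
           + (fv * g (a s) (b s) + f (a s) (b s) * gv) * b')
    with ((fu * a' + fv * b') * g (a s) (b s) + f (a s) (b s) * (gu * a' + gv * b')) by ring.
  apply (is_derive_mult (fun r => f (a r) (b r)) (fun r => g (a r) (b r)));
    [apply F|apply G|intros; apply Rmult_comm]; auto.
Qed.

Lemma pdiff_inv f u v fu fv :
  pdiff f u v fu fv -> f u v <> 0 ->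
  pdiff (fun u v => / f u v) u v (- fu / f u v ^ 2) (- fv / f u v ^ 2).
Proof.
  intros F N a b s a' b' Ea Eb Ha Hb. subst u v.
  replace (- fu / f (a s) (b s) ^ 2 * a' + - fv / f (a s) (b s) ^ 2 * b')
    with (- (fu * a' + fv * b') / f (a s) (b s) ^ 2) by (field; exact N).
  apply (is_derive_inv (fun r => f (a r) (b r))); [apply F|]; auto.
Qed.

Lemma pdiff_sqrt f u v fu fv :
  pdiff f u v fu fv -> 0 < f u v ->
  pdiff (fun u v => sqrt (f u v)) u v (fu / (2 * sqrt (f u v))) (fv / (2 * sqrt (f u v))).
Proof.
  intros F N a b s a' b' Ea Eb Ha Hb. subst u v.
  replace (fu / (2 * sqrt (f (a s) (b s))) * a' + fv / (2 * sqrt (f (a s) (b s))) * b')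
    with ((fu * a' + fv * b') / (2 * sqrt (f (a s) (b s))))
    by (field; pose proof (sqrt_lt_R0 _ N); lra).
  apply (is_derive_sqrt (fun r => f (a r) (b r))); [apply F|]; auto.
Qed.

Definition pdu (f : R -> R -> R) (u v : R) : R := Derive (fun s => f s v) u.
Definition pdv (f : R -> R -> R) (u v : R) : R := Derive (fun s => f u s) v.

Lemma smooth_on_pdu U f : smooth_on U f -> smooth_on U (pdu f).
Proof. intros H u v Huv n. exact (proj1 (proj2 (proj2 (proj2 (H u v Huv (S n)))))). Qed.

Lemma smooth_on_pdv U f : smooth_on U f -> smooth_on U (pdv f).
Proof. intros H u v Huv n. exact (proj2 (proj2 (proj2 (proj2 (H u v Huv (S n)))))). Qed.

Lemma smooth_on_pdiff U f u v :
  open U -> smooth_on U f -> U (u, v) -> pdiff f u v (pdu f u v) (pdv f u v).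
Proof.
  intros HU Hf Huv a b s a' b' Ea Eb Ha Hb.
  assert (D : filterdiff (fun z : R * R => f (fst z) (snd z)) (locally (u, v))
     (fun z : R * R => plus (scal (fst z) (pdu f u v)) (scal (snd z) (pdv f u v)))).
  { apply is_derive_filterdiff.
    - generalize (HU (u, v) Huv). apply filter_imp. intros [x y] Hxy. cbn [fst snd].
      apply Derive_correct. exact (proj1 (proj2 (Hf x y Hxy 1%nat))).
    - apply Derive_correct. exact (proj1 (proj2 (proj2 (Hf u v Huv 1%nat)))).
    - unfold continuous. apply continuity_2d_pt_filterlim.
      exact (proj1 (smooth_on_pdu U f Hf u v Huv 0%nat)). }
  subst u v.
  unfold is_derive.
  apply filterdiff_ext_lin with (fun y =>
    plus (scal (scal y a') (pdu f (a s) (b s))) (scal (scal y b') (pdv f (a s) (b s)))).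
  - apply (filterdiff_comp'_2 a b f s (fun y => scal y a') (fun y => scal y b')
      (fun x y => plus (scal x (pdu f (a s) (b s))) (scal y (pdv f (a s) (b s))))); assumption.
  - intros y. unfold scal, plus; simpl; unfold mult; simpl; ring.
Qed.

(* [n] is the unit normal, [m] one of its partial derivatives and [T] the matching
   dual tangent vector.  Summed over both parameters, the left-hand side is the
   anisotropic mean curvature and the right-hand side is [- 2] times the
   divergence of [(n1 / n3, n2 / n3)] in the [(x, y)]-plane. *)
Lemma divergence_of_slope (n1 n2 n3 m1 m2 m3 T1 T2 T3 : R) :
  n3 <> 0 -> n1 * m1 + n2 * m2 + n3 * m3 = 0 -> n1 * T1 + n2 * T2 + n3 * T3 = 0 ->
  n1 * n1 + n2 * n2 + n3 * n3 = 1 ->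
  - (m1 * T1 + m2 * T2 + m3 * T3) * (/ n3 - n3)
  - (((- m3 / n3 ^ 2 + m3) * n1 + (/ n3 + n3) * m1) * T1
     + ((- m3 / n3 ^ 2 + m3) * n2 + (/ n3 + n3) * m2) * T2
     + (2 * n3 * m3 + 2 * m3 / n3 ^ 3) * T3)
  = - 2 * ((m1 * n3 - n1 * m3) / n3 ^ 2 * (T1 - n1 / n3 * T3)
           + (m2 * n3 - n2 * m3) / n3 ^ 2 * (T2 - n2 / n3 * T3)).
Proof.
  intros N Hm HT H1.
  transitivity (- 2 / n3 * (m1 * T1 + m2 * T2 + m3 * T3 + m3 * T3 / n3 ^ 2)
                - (m3 - m3 / n3 ^ 2) * (n1 * T1 + n2 * T2 + n3 * T3)); [field; exact N|].
  transitivity (- 2 / n3 * (m1 * T1 + m2 * T2 + m3 * T3 + m3 * T3 / n3 ^ 2)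
                - 2 / n3 ^ 2 * (- m3 * (n1 * T1 + n2 * T2 + n3 * T3)
                    - T3 * (n1 * m1 + n2 * m2 + n3 * m3)
                    + m3 * T3 * (n1 * n1 + n2 * n2 + n3 * n3 - 1) / n3)); [|field; exact N].
  rewrite Hm, HT, H1; field; exact N.
Qed.

Lemma sphere_gradient_dirichlet (n : V3) : zc n <> 0 ->
  sphere_gradient dirichlet_integrand n =
  ((/ zc n + zc n) * xc n, (/ zc n + zc n) * yc n, zc n * zc n - / (zc n * zc n)).
Proof.
  intros N. destruct n as [[n1 n2] n3]. unfold zc in N; cbn [fst snd] in N.
  assert (E : gradient dirichlet_integrand (n1, n2, n3) = (0, 0, - / n3 ^ 2 - 1)).
  { unfold gradient, dirichlet_integrand, xc, yc, zc; cbn [fst snd].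
    f_equal; [f_equal; apply Derive_const|].
    apply is_derive_unique. auto_derive; [exact N|field; exact N]. }
  unfold sphere_gradient. rewrite E.
  set (q := dot (0, 0, - / n3 ^ 2 - 1) (n1, n2, n3)).
  transitivity (0 + - (q * n1), 0 + - (q * n2), - / n3 ^ 2 - 1 + - (q * n3)); [reflexivity|].
  unfold q, dot, xc, yc, zc; cbn [fst snd].
  apply injective_projections; cbn [fst snd]; [apply injective_projections; cbn [fst snd]|];
    field; exact N.
Qed.

Lemma is_derive_sphere_gradient (n : R -> V3) (s m1 m2 m3 : R) :
  is_derive (fun r => xc (n r)) s m1 -> is_derive (fun r => yc (n r)) s m2 ->
  is_derive (fun r => zc (n r)) s m3 -> zc (n s) <> 0 ->
  let V := fun r => sphere_gradient dirichlet_integrand (n r) in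
  let k := - m3 / zc (n s) ^ 2 + m3 in let h := / zc (n s) + zc (n s) in
  Derive (fun r => xc (V r)) s = k * xc (n s) + h * m1 /\
  Derive (fun r => yc (V r)) s = k * yc (n s) + h * m2 /\
  Derive (fun r => zc (V r)) s = 2 * zc (n s) * m3 + 2 * m3 / zc (n s) ^ 3.
Proof.
  intros D1 D2 D3 N V k h.
  (* The closed form of the sphere gradient is available only where the third component is nonzero,
     an open condition along the curve. *)
  assert (L : locally s (fun r => zc (n r) <> 0)).
  { apply (ex_derive_continuous (fun r => zc (n r)) s (ex_intro _ _ D3)
             (fun w => w <> 0)).
    apply open_neq; exact N. }
  assert (E : locally s (fun r =>
      (/ zc (n r) + zc (n r)) * xc (n r) = xc (V r) /\
      (/ zc (n r) + zc (n r)) * yc (n r) = yc (V r) /\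
      zc (n r) * zc (n r) - / (zc (n r) * zc (n r)) = zc (V r))).
  { revert L; apply filter_imp; intros r Hr. unfold V.
    rewrite sphere_gradient_dirichlet by exact Hr. repeat split; reflexivity. }
  assert (Dh : is_derive (fun r => / zc (n r) + zc (n r)) s k).
  { apply (is_derive_plus (fun r => / zc (n r)) (fun r => zc (n r))); [|exact D3].
    apply is_derive_inv; assumption. }
  split; [|split]; apply is_derive_unique.
  - apply (is_derive_ext_loc (fun r => (/ zc (n r) + zc (n r)) * xc (n r)));
      [revert E; apply filter_imp; tauto|].
    apply (is_derive_mult (fun r => / zc (n r) + zc (n r)) (fun r => xc (n r)));
      [exact Dh|exact D1|intros; apply Rmult_comm].
  - apply (is_derive_ext_loc (fun r => (/ zc (n r) + zc (n r)) * yc (n r)));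
      [revert E; apply filter_imp; tauto|].
    apply (is_derive_mult (fun r => / zc (n r) + zc (n r)) (fun r => yc (n r)));
      [exact Dh|exact D2|intros; apply Rmult_comm].
  - apply (is_derive_ext_loc (fun r => zc (n r) * zc (n r) - / (zc (n r) * zc (n r))));
      [revert E; apply filter_imp; tauto|].
    assert (Dq : is_derive (fun r => zc (n r) * zc (n r)) s (m3 * zc (n s) + zc (n s) * m3))
      by (apply (is_derive_mult (fun r => zc (n r)) (fun r => zc (n r)));
          [exact D3|exact D3|intros; apply Rmult_comm]).
    replace (2 * zc (n s) * m3 + 2 * m3 / zc (n s) ^ 3) with
      (m3 * zc (n s) + zc (n s) * m3
       - - (m3 * zc (n s) + zc (n s) * m3) / (zc (n s) * zc (n s)) ^ 2)
      by (field; exact N).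
    apply (is_derive_minus (fun r => zc (n r) * zc (n r)) (fun r => / (zc (n r) * zc (n r))));
      [exact Dq|].
    apply (is_derive_inv (fun r => zc (n r) * zc (n r))); [exact Dq|].
    apply Rmult_integral_contrapositive_currified; exact N.
Qed.

(* [T] and [T'] form the basis of the tangent plane dual to [X_u], [X_v]; the
   conclusion says that [(A, B)] has zero divergence in the plane. *)
Lemma slope_divergence
  (xu yu zu xv yv zv k c d a1 b1 a2 b2 a3 b3 : R) :
  let W1 := yu * zv - zu * yv in let W2 := zu * xv - xu * zv in
  let W3 := xu * yv - yu * xv in
  let n1 := k * W1 in let n2 := k * W2 in let n3 := k * W3 in
  let m1 := c * W1 + k * a1 in let m2 := c * W2 + k * a2 in let m3 := c * W3 + k * a3 in
  let p1 := d * W1 + k * b1 in let p2 := d * W2 + k * b2 in let p3 := d * W3 + k * b3 in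
  let g11 := xu * xu + yu * yu + zu * zu in let g12 := xu * xv + yu * yv + zu * zv in
  let g22 := xv * xv + yv * yv + zv * zv in
  let div := fun U1 U2 U3 V1 V2 V3 =>
    (g22 * (U1 * xu + U2 * yu + U3 * zu)
     - g12 * ((U1 * xv + U2 * yv + U3 * zv) + (V1 * xu + V2 * yu + V3 * zu))
     + g11 * (V1 * xv + V2 * yv + V3 * zv)) / (g11 * g22 - g12 * g12) in
  0 < W1 * W1 + W2 * W2 + W3 * W3 -> W3 <> 0 -> k <> 0 ->
  n1 * n1 + n2 * n2 + n3 * n3 = 1 ->
  n1 * m1 + n2 * m2 + n3 * m3 = 0 -> n1 * p1 + n2 * p2 + n3 * p3 = 0 ->
  2 * (- div m1 m2 m3 p1 p2 p3 / 2) * (/ n3 - n3)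
  - div ((- m3 / n3 ^ 2 + m3) * n1 + (/ n3 + n3) * m1)
        ((- m3 / n3 ^ 2 + m3) * n2 + (/ n3 + n3) * m2)
        (2 * n3 * m3 + 2 * m3 / n3 ^ 3)
        ((- p3 / n3 ^ 2 + p3) * n1 + (/ n3 + n3) * p1)
        ((- p3 / n3 ^ 2 + p3) * n2 + (/ n3 + n3) * p2)
        (2 * n3 * p3 + 2 * p3 / n3 ^ 3) = 0 ->
  (a1 * / W3 + W1 * (- a3 / W3 ^ 2)) * yv - (b1 * / W3 + W1 * (- b3 / W3 ^ 2)) * yu
  + xu * (b2 * / W3 + W2 * (- b3 / W3 ^ 2)) - xv * (a2 * / W3 + W2 * (- a3 / W3 ^ 2)) = 0.
Proof.
  intros W1 W2 W3 n1 n2 n3 m1 m2 m3 p1 p2 p3 g11 g12 g22 div HW H3 Hk H1 Hm Hp HL.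
  set (D := g11 * g22 - g12 * g12).
  assert (ED : D = W1 * W1 + W2 * W2 + W3 * W3)
    by (unfold D, g11, g12, g22, W1, W2, W3; ring).
  assert (HD : D <> 0) by lra.
  assert (N : n3 <> 0) by (apply Rmult_integral_contrapositive_currified; assumption).
  set (T1 := (g22 * xu - g12 * xv) / D). set (T2 := (g22 * yu - g12 * yv) / D).
  set (T3 := (g22 * zu - g12 * zv) / D).
  set (T1' := (g11 * xv - g12 * xu) / D). set (T2' := (g11 * yv - g12 * yu) / D).
  set (T3' := (g11 * zv - g12 * zu) / D).
  assert (Ediv : forall U1 U2 U3 V1 V2 V3, div U1 U2 U3 V1 V2 V3 =
     (U1 * T1 + U2 * T2 + U3 * T3) + (V1 * T1' + V2 * T2' + V3 * T3')).
  { intros. unfold div; fold D. unfold T1, T2, T3, T1', T2', T3'. field. exact HD. }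
  rewrite !Ediv in HL.
  assert (NT : n1 * T1 + n2 * T2 + n3 * T3 = 0).
  { transitivity (k * (W1 * (g22 * xu - g12 * xv) + W2 * (g22 * yu - g12 * yv)
                       + W3 * (g22 * zu - g12 * zv)) / D).
    - unfold n1, n2, n3, T1, T2, T3; field; exact HD.
    - unfold W1, W2, W3; field; exact HD. }
  assert (NT' : n1 * T1' + n2 * T2' + n3 * T3' = 0).
  { transitivity (k * (W1 * (g11 * xv - g12 * xu) + W2 * (g11 * yv - g12 * yu)
                       + W3 * (g11 * zv - g12 * zu)) / D).
    - unfold n1, n2, n3, T1', T2', T3'; field; exact HD.
    - unfold W1, W2, W3; field; exact HD. }
  pose proof (divergence_of_slope n1 n2 n3 m1 m2 m3 T1 T2 T3 N Hm NT H1) as E1.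
  pose proof (divergence_of_slope n1 n2 n3 p1 p2 p3 T1' T2' T3' N Hp NT' H1) as E2.
  (* [T - (T3 / n3) n] is horizontal: it is the gradient of the parameter [u] as a function of
     [(x, y)], and the primed version is that of [v]. *)
  assert (X1 : T1 - n1 / n3 * T3 = yv / W3).
  { transitivity (((g22 * xu - g12 * xv) * W3 - W1 * (g22 * zu - g12 * zv)) / (D * W3));
      [unfold T1, T3, n1, n3; field; repeat split; assumption|].
    replace ((g22 * xu - g12 * xv) * W3 - W1 * (g22 * zu - g12 * zv)) with (yv * D)
      by (unfold D, g11, g12, g22, W1, W3; ring).
    field; split; assumption. }
  assert (X2 : T2 - n2 / n3 * T3 = - xv / W3).
  { transitivity (((g22 * yu - g12 * yv) * W3 - W2 * (g22 * zu - g12 * zv)) / (D * W3));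
      [unfold T2, T3, n2, n3; field; repeat split; assumption|].
    replace ((g22 * yu - g12 * yv) * W3 - W2 * (g22 * zu - g12 * zv)) with (- xv * D)
      by (unfold D, g11, g12, g22, W2, W3; ring).
    field; split; assumption. }
  assert (X1' : T1' - n1 / n3 * T3' = - yu / W3).
  { transitivity (((g11 * xv - g12 * xu) * W3 - W1 * (g11 * zv - g12 * zu)) / (D * W3));
      [unfold T1', T3', n1, n3; field; repeat split; assumption|].
    replace ((g11 * xv - g12 * xu) * W3 - W1 * (g11 * zv - g12 * zu)) with (- yu * D)
      by (unfold D, g11, g12, g22, W1, W3; ring).
    field; split; assumption. }
  assert (X2' : T2' - n2 / n3 * T3' = xu / W3).
  { transitivity (((g11 * yv - g12 * yu) * W3 - W2 * (g11 * zv - g12 * zu)) / (D * W3));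
      [unfold T2', T3', n2, n3; field; repeat split; assumption|].
    replace ((g11 * yv - g12 * yu) * W3 - W2 * (g11 * zv - g12 * zu)) with (xu * D)
      by (unfold D, g11, g12, g22, W2, W3; ring).
    field; split; assumption. }
  rewrite X1, X2 in E1. rewrite X1', X2' in E2.
  (* The slopes [W1 / W3] and [W2 / W3] do not see the normalizing factor [k], so its derivatives
     [c] and [d] cancel. *)
  assert (Q : forall w a, ((c * w + k * a) * n3 - k * w * m3) / n3 ^ 2 = a * / W3 + w * (- a3 / W3 ^ 2))
    by (intros w a; unfold m3, n3; field; split; assumption).
  assert (Q' : forall w b, ((d * w + k * b) * n3 - k * w * p3) / n3 ^ 2 = b * / W3 + w * (- b3 / W3 ^ 2))
    by (intros w b; unfold p3, n3; field; split; assumption).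
  assert (Q1 := Q W1 a1); assert (Q2 := Q W2 a2).
  assert (Q1' := Q' W1 b1); assert (Q2' := Q' W2 b2). clear Q Q'.
  fold n1 m1 in Q1; fold n2 m2 in Q2; fold n1 p1 in Q1'; fold n2 p2 in Q2'.
  rewrite Q1, Q2 in E1; rewrite Q1', Q2' in E2.
  (* The factor [- 2] comes from [divergence_of_slope], and [1 / W3] from the gradients of the
     parameters. *)
  apply Rmult_eq_reg_l with (- 2 / W3); [|apply Rmult_integral_contrapositive_currified;
    [lra|apply Rinv_neq_0_compat; exact H3]].
  rewrite Rmult_0_r, <- HL.
  match type of E1 with ?l = _ => match type of E2 with ?l' = _ =>
    transitivity (l + l') end end; [|field; exact N].
  rewrite E1, E2. field; exact H3.
Qed.

(** * The normal of an immersion and its slopes *)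

Definition cx (X : R -> R -> V3) (u v : R) : R := xc (X u v).
Definition cy (X : R -> R -> V3) (u v : R) : R := yc (X u v).
Definition cz (X : R -> R -> V3) (u v : R) : R := zc (X u v).

(* The components of [X_u x X_v]. *)
Definition w1 (X : R -> R -> V3) (u v : R) : R :=
  pdu (cy X) u v * pdv (cz X) u v - pdu (cz X) u v * pdv (cy X) u v.
Definition w2 (X : R -> R -> V3) (u v : R) : R :=
  pdu (cz X) u v * pdv (cx X) u v - pdu (cx X) u v * pdv (cz X) u v.
Definition w3 (X : R -> R -> V3) (u v : R) : R :=
  pdu (cx X) u v * pdv (cy X) u v - pdu (cy X) u v * pdv (cx X) u v.
Definition nrm (X : R -> R -> V3) (u v : R) : R :=
  sqrt (w1 X u v * w1 X u v + w2 X u v * w2 X u v + w3 X u v * w3 X u v).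

Lemma unit_normal_coordinates X u v :
  unit_normal X u v = (/ nrm X u v * w1 X u v, / nrm X u v * w2 X u v, / nrm X u v * w3 X u v).
Proof. reflexivity. Qed.

Lemma normal_length_pos U X u v : dirichlet_minimal_surface U X -> U (u, v) ->
  0 < w1 X u v * w1 X u v + w2 X u v * w2 X u v + w3 X u v * w3 X u v.
Proof.
  intros minimal Huv. destruct minimal as [(_ & _ & H) _].
  specialize (H u v Huv).
  pose proof (Rle_0_sqr (w1 X u v)); pose proof (Rle_0_sqr (w2 X u v));
    pose proof (Rle_0_sqr (w3 X u v)); unfold Rsqr in *.
  destruct (Req_dec (w1 X u v * w1 X u v + w2 X u v * w2 X u v + w3 X u v * w3 X u v) 0) as [E|E]; [|lra].
  exfalso; apply H.
  assert (E1 : w1 X u v = 0) by (apply Rsqr_0_uniq; unfold Rsqr; lra).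
  assert (E2 : w2 X u v = 0) by (apply Rsqr_0_uniq; unfold Rsqr; lra).
  assert (E3 : w3 X u v = 0) by (apply Rsqr_0_uniq; unfold Rsqr; lra).
  transitivity (w1 X u v, w2 X u v, w3 X u v); [reflexivity|]. rewrite E1, E2, E3; reflexivity.
Qed.

Lemma normal_not_horizontal U X u v : dirichlet_minimal_surface U X -> U (u, v) -> w3 X u v <> 0.
Proof.
  intros minimal Huv E. destruct minimal as [_ H]. destruct (H u v Huv) as [N _].
  apply N. rewrite unit_normal_coordinates, E. unfold zc; cbn [fst snd]; ring.
Qed.

(** Existence is enough: [slope_divergence] takes these derivatives as arbitrary reals, tied only by
    the differentiated unit length and the curvature equation. *)
Lemma normal_pdiff U X u v : dirichlet_minimal_surface U X -> U (u, v) ->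
  exists a1 b1 a2 b2 a3 b3 c d,
    pdiff (w1 X) u v a1 b1 /\ pdiff (w2 X) u v a2 b2 /\ pdiff (w3 X) u v a3 b3 /\ 
    pdiff (fun u v => / nrm X u v) u v c d.
Proof.
  intros minimal Huv. pose proof (normal_length_pos U X u v minimal Huv) as Hp.
  destruct minimal as [(HU & (Hx & Hy & Hz) & _) _].
  change (smooth_on U (cx X)) in Hx; change (smooth_on U (cy X)) in Hy;
    change (smooth_on U (cz X)) in Hz.
  assert (Du : forall f, smooth_on U f -> exists a b, pdiff (pdu f) u v a b)
    by (intros f Hf; do 2 eexists; apply (smooth_on_pdiff U);
        [exact HU|apply smooth_on_pdu; exact Hf|exact Huv]).
  assert (Dv : forall f, smooth_on U f -> exists a b, pdiff (pdv f) u v a b)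
    by (intros f Hf; do 2 eexists; apply (smooth_on_pdiff U);
        [exact HU|apply smooth_on_pdv; exact Hf|exact Huv]).
  destruct (Du _ Hx) as (? & ? & X1), (Dv _ Hx) as (? & ? & X2),
    (Du _ Hy) as (? & ? & Y1), (Dv _ Hy) as (? & ? & Y2),
    (Du _ Hz) as (? & ? & Z1), (Dv _ Hz) as (? & ? & Z2).
  assert (exists a b, pdiff (w1 X) u v a b) as (a1 & b1 & W1)
    by (do 2 eexists; apply pdiff_minus; apply pdiff_mult; eassumption).
  assert (exists a b, pdiff (w2 X) u v a b) as (a2 & b2 & W2)
    by (do 2 eexists; apply pdiff_minus; apply pdiff_mult; eassumption).
  assert (exists a b, pdiff (w3 X) u v a b) as (a3 & b3 & W3)
    by (do 2 eexists; apply pdiff_minus; apply pdiff_mult; eassumption).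
  do 6 eexists.
  assert (exists c d, pdiff (fun u v => / nrm X u v) u v c d) as (c & d & N).
  { do 2 eexists; apply pdiff_inv; [apply pdiff_sqrt; [|exact Hp]|].
    - apply pdiff_plus; [apply pdiff_plus|]; apply pdiff_mult; eassumption.
    - pose proof (sqrt_lt_R0 _ Hp). apply Rgt_not_eq. assumption. }
  exists c, d. split; [exact W1|split; [exact W2|split; [exact W3|exact N]]].
Qed.

Definition slope_x (X : R -> R -> V3) (u v : R) : R := w1 X u v / w3 X u v.
Definition slope_y (X : R -> R -> V3) (u v : R) : R := w2 X u v / w3 X u v.

Lemma unit_normal_unit U X u v : dirichlet_minimal_surface U X -> U (u, v) ->
  / nrm X u v * w1 X u v * (/ nrm X u v * w1 X u v)
  + / nrm X u v * w2 X u v * (/ nrm X u v * w2 X u v)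
  + / nrm X u v * w3 X u v * (/ nrm X u v * w3 X u v) = 1.
Proof.
  intros minimal Huv. pose proof (normal_length_pos U X u v minimal Huv) as P.
  set (q := w1 X u v * w1 X u v + w2 X u v * w2 X u v + w3 X u v * w3 X u v) in P.
  assert (E : nrm X u v * nrm X u v = q) by (apply sqrt_sqrt; lra).
  assert (N : nrm X u v <> 0) by (apply Rgt_not_eq; exact (sqrt_lt_R0 _ P)).
  transitivity (q / (nrm X u v * nrm X u v)); [unfold q; field; exact N|].
  rewrite E; field; lra.
Qed.

Lemma unit_orthogonal_derivative (f1 f2 f3 : R -> R) (s m1 m2 m3 : R) :
  is_derive f1 s m1 -> is_derive f2 s m2 -> is_derive f3 s m3 ->
  locally s (fun r => f1 r * f1 r + f2 r * f2 r + f3 r * f3 r = 1) ->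
  f1 s * m1 + f2 s * m2 + f3 s * m3 = 0.
Proof.
  intros D1 D2 D3 L.
  assert (E : is_derive (fun r => f1 r * f1 r + f2 r * f2 r + f3 r * f3 r) s
    ((m1 * f1 s + f1 s * m1) + (m2 * f2 s + f2 s * m2) + (m3 * f3 s + f3 s * m3))).
  { apply (is_derive_plus (fun r => f1 r * f1 r + f2 r * f2 r) (fun r => f3 r * f3 r)).
    - apply (is_derive_plus (fun r => f1 r * f1 r) (fun r => f2 r * f2 r)).
      + apply (is_derive_mult f1 f1); auto using Rmult_comm.
      + apply (is_derive_mult f2 f2); auto using Rmult_comm.
    - apply (is_derive_mult f3 f3); auto using Rmult_comm. }
  apply (is_derive_ext_loc _ (fun _ => 1) _ _ L) in E.
  apply is_derive_unique in E. rewrite Derive_const in E. lra.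
Qed.

(** The divergence of the slopes in the [(x, y)]-plane, multiplied by the Jacobian [w3]. The
    anisotropic mean curvature is unfolded only here; from now on the surface enters through its
    slopes. *)
Lemma slope_pdiff U X u v : dirichlet_minimal_surface U X -> U (u, v) ->
  exists Au Av Bu Bv,
    pdiff (slope_x X) u v Au Av /\ pdiff (slope_y X) u v Bu Bv /\
    Au * pdv (cy X) u v - Av * pdu (cy X) u v
    + pdu (cx X) u v * Bv - pdv (cx X) u v * Bu = 0.
Proof.
  intros minimal Huv.
  destruct (normal_pdiff U X u v minimal Huv)
    as (a1 & b1 & a2 & b2 & a3 & b3 & c & d & W1 & W2 & W3 & N).
  pose proof (normal_not_horizontal U X u v minimal Huv) as H3.
  pose proof (normal_length_pos U X u v minimal Huv) as Hp.
  do 4 eexists. split; [|split].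
  { apply (pdiff_mult (w1 X) (fun u v => / w3 X u v));
      [exact W1|apply pdiff_inv; [exact W3|exact H3]]. }
  { apply (pdiff_mult (w2 X) (fun u v => / w3 X u v));
      [exact W2|apply pdiff_inv; [exact W3|exact H3]]. }
  pose proof (pdiff_mult _ _ _ _ _ _ _ _ N W1) as N1.
  pose proof (pdiff_mult _ _ _ _ _ _ _ _ N W2) as N2.
  pose proof (pdiff_mult _ _ _ _ _ _ _ _ N W3) as N3.
  cbv beta in N1, N2, N3.
  pose proof minimal as [(HU & _ & HX) HL].
  destruct (HL u v Huv) as [Hz HL0]. rewrite unit_normal_coordinates in Hz.
  destruct (is_derive_sphere_gradient (fun s => unit_normal X s v) u _ _ _
    (pdiff_u _ _ _ _ _ N1) (pdiff_u _ _ _ _ _ N2) (pdiff_u _ _ _ _ _ N3) Hz)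
    as (G1 & G2 & G3).
  destruct (is_derive_sphere_gradient (fun s => unit_normal X u s) v _ _ _
    (pdiff_v _ _ _ _ _ N1) (pdiff_v _ _ _ _ _ N2) (pdiff_v _ _ _ _ _ N3) Hz)
    as (G1' & G2' & G3').
  pose proof (is_derive_unique _ _ _ (pdiff_u _ _ _ _ _ N1)) as D1.
  pose proof (is_derive_unique _ _ _ (pdiff_u _ _ _ _ _ N2)) as D2.
  pose proof (is_derive_unique _ _ _ (pdiff_u _ _ _ _ _ N3)) as D3.
  pose proof (is_derive_unique _ _ _ (pdiff_v _ _ _ _ _ N1)) as D1'.
  pose proof (is_derive_unique _ _ _ (pdiff_v _ _ _ _ _ N2)) as D2'.
  pose proof (is_derive_unique _ _ _ (pdiff_v _ _ _ _ _ N3)) as D3'.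
  rewrite unit_normal_coordinates in G1, G2, G3, G1', G2', G3'.
  assert (O : / nrm X u v * w1 X u v * (c * w1 X u v + / nrm X u v * a1)
    + / nrm X u v * w2 X u v * (c * w2 X u v + / nrm X u v * a2)
    + / nrm X u v * w3 X u v * (c * w3 X u v + / nrm X u v * a3) = 0).
  { apply (unit_orthogonal_derivative _ _ _ u _ _ _
      (pdiff_u _ _ _ _ _ N1) (pdiff_u _ _ _ _ _ N2) (pdiff_u _ _ _ _ _ N3)).
    destruct (HU (u, v) Huv) as [eps He]. exists eps. intros s Hs.
    apply unit_normal_unit with (1 := minimal). apply He.
    split; [exact Hs|apply ball_center]. }
  assert (O' : / nrm X u v * w1 X u v * (d * w1 X u v + / nrm X u v * b1)
    + / nrm X u v * w2 X u v * (d * w2 X u v + / nrm X u v * b2)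
    + / nrm X u v * w3 X u v * (d * w3 X u v + / nrm X u v * b3) = 0).
  { apply (unit_orthogonal_derivative _ _ _ v _ _ _
      (pdiff_v _ _ _ _ _ N1) (pdiff_v _ _ _ _ _ N2) (pdiff_v _ _ _ _ _ N3)).
    destruct (HU (u, v) Huv) as [eps He]. exists eps. intros s Hs.
    apply unit_normal_unit with (1 := minimal). apply He.
    split; [apply ball_center|exact Hs]. }
  assert (K : / nrm X u v <> 0)
    by (apply Rinv_neq_0_compat, Rgt_not_eq; exact (sqrt_lt_R0 _ Hp)).
  pose proof (unit_normal_unit U X u v minimal Huv) as H1.
  apply (slope_divergence (pdu (cx X) u v) (pdu (cy X) u v) (pdu (cz X) u v)
    (pdv (cx X) u v) (pdv (cy X) u v) (pdv (cz X) u v) (/ nrm X u v) c d a1 b1 a2 b2 a3 b3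
    Hp H3 K H1 O O').
  refine (eq_trans _ HL0). symmetry.
  unfold anisotropic_mean_curvature, mean_curvature, div_surface.
  replace (d_u (unit_normal X) u v) with
    (c * w1 X u v + / nrm X u v * a1, c * w2 X u v + / nrm X u v * a2,
     c * w3 X u v + / nrm X u v * a3)
    by (rewrite <- D1, <- D2, <- D3; reflexivity).
  replace (d_v (unit_normal X) u v) with
    (d * w1 X u v + / nrm X u v * b1, d * w2 X u v + / nrm X u v * b2,
     d * w3 X u v + / nrm X u v * b3)
    by (rewrite <- D1', <- D2', <- D3'; reflexivity).
  set (V := fun s t => sphere_gradient dirichlet_integrand (unit_normal X s t)).
  replace (d_u V u v) with
    (Derive (fun r => xc (V r v)) u, Derive (fun r => yc (V r v)) u,
     Derive (fun r => zc (V r v)) u) by reflexivity.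
  replace (d_v V u v) with
    (Derive (fun r => xc (V u r)) v, Derive (fun r => yc (V u r)) v,
     Derive (fun r => zc (V u r)) v) by reflexivity.
  unfold V. rewrite G1, G2, G3, G1', G2', G3'. reflexivity.
Qed.

(** * Circle coordinates *)

Lemma open_index (C : circle_family) : open (index C).
Proof. apply open_and; [apply open_Rbar_gt|apply open_Rbar_lt]. Qed.

Lemma index_locally (C : circle_family) (s : R) : index C s -> locally s (index C).
Proof. exact (open_index C s). Qed.

Lemma index_between (C : circle_family) (s1 s2 t : R) :
  index C s1 -> index C s2 -> s1 <= t <= s2 -> index C t.
Proof.
  intros [H1 _] [_ H2] [T1 T2]; split.
  - apply Rbar_lt_le_trans with s1; [exact H1|exact T1].
  - apply Rbar_le_lt_trans with s2; [exact T2|exact H2].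
Qed.

Lemma constant_on_index (C : circle_family) (f : R -> R) (s1 s2 : R) :
  (forall s, index C s -> is_derive f s 0) -> index C s1 -> index C s2 -> f s1 = f s2.
Proof.
  intros H.
  assert (L : forall s1 s2, s1 < s2 -> index C s1 -> index C s2 -> f s1 = f s2).
  { intros r1 r2 Hr H1 H2. apply eq_is_derive; [|exact Hr].
    intros t Ht. apply H. exact (index_between C r1 r2 t H1 H2 Ht). }
  intros H1 H2. destruct (Rtotal_order s1 s2) as [E|[E|E]].
  - apply L; assumption.
  - rewrite E; reflexivity.
  - symmetry; apply L; assumption.
Qed.

Lemma is_derive_eq_on_index (C : circle_family) (f g : R -> R) (s l m : R) :
  index C s -> (forall r, index C r -> f r = g r) ->
  is_derive f s l -> is_derive g s m -> l = m.
Proof.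
  intros Hs E Hf Hg.
  rewrite <- (is_derive_unique _ _ _ Hf), <- (is_derive_unique _ _ _ Hg).
  apply Derive_ext_loc. generalize (index_locally C s Hs). apply filter_imp; exact E.
Qed.

(** The slopes are chosen before [s] and [t], so that the tangency relations hold at neighbouring
    parameters and can be differentiated later. Passing to circle coordinates multiplies the
    divergence expression and [w3] by the Jacobian of [(phi, psi)]. *)
Lemma foliation_slopes U X C :
  dirichlet_minimal_surface U X -> foliated_by U X C ->
  exists A B : R -> R -> R, forall s t, index C s ->
  exists As At Bs Bt xs xt ys yt zs zt,
    is_derive (fun r => A r t) s As /\ is_derive (fun r => A s r) t At /\
    is_derive (fun r => B r t) s Bs /\ is_derive (fun r => B s r) t Bt /\
    is_derive (fun r => xc (circle_point C r t)) s xs /\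
    is_derive (fun r => xc (circle_point C s r)) t xt /\
    is_derive (fun r => yc (circle_point C r t)) s ys /\
    is_derive (fun r => yc (circle_point C s r)) t yt /\
    is_derive (fun r => zc (circle_point C r t)) s zs /\
    is_derive (fun r => zc (circle_point C s r)) t zt /\
    A s t * xs + B s t * ys + zs = 0 /\ A s t * xt + B s t * yt + zt = 0 /\
    As * yt - At * ys + xs * Bt - xt * Bs = 0 /\ xs * yt - xt * ys <> 0.
Proof.
  intros minimal (_ & phi & psi & Hphi & Hpsi & HU & _ & _ & HJ & HX).
  exists (fun s t => slope_x X (phi s t) (psi s t)), (fun s t => slope_y X (phi s t) (psi s t)).
  intros s t Hs.
  set (u := phi s t). set (v := psi s t).
  assert (Huv : U (u, v)) by exact (HU s t Hs).
  assert (HS : open (fun p : R * R => index C (fst p))).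
  { apply (open_comp fst); [|apply open_index]. intros p _. apply continuous_fst. }
  pose proof (smooth_on_pdiff _ phi s t HS Hphi Hs) as Dphi.
  pose proof (smooth_on_pdiff _ psi s t HS Hpsi Hs) as Dpsi.
  pose proof (pdiff_u _ _ _ _ _ Dphi) as Fs. pose proof (pdiff_v _ _ _ _ _ Dphi) as Ft.
  pose proof (pdiff_u _ _ _ _ _ Dpsi) as Gs. pose proof (pdiff_v _ _ _ _ _ Dpsi) as Gt.
  pose proof (HJ s t Hs) as J.
  change (pdu phi s t * pdv psi s t - pdv phi s t * pdu psi s t <> 0) in J.
  set (fs := pdu phi s t) in *; set (ft := pdv phi s t) in *.
  set (gs := pdu psi s t) in *; set (gt := pdv psi s t) in *.
  destruct (slope_pdiff U X u v minimal Huv) as (Au & Av & Bu & Bv & DA & DB & E).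
  pose proof (normal_not_horizontal U X u v minimal Huv) as H3.
  destruct minimal as [(HO & (Hx & Hy & Hz) & _) _].
  pose proof (smooth_on_pdiff U (cx X) u v HO Hx Huv) as Dx.
  pose proof (smooth_on_pdiff U (cy X) u v HO Hy Huv) as Dy.
  pose proof (smooth_on_pdiff U (cz X) u v HO Hz Huv) as Dz.
  assert (Ls : forall p : V3 -> R, locally s (fun r =>
     p (X (phi r t) (psi r t)) = p (circle_point C r t))).
  { intros p. generalize (index_locally C s Hs); apply filter_imp; intros r Hr.
    rewrite HX by exact Hr; reflexivity. }
  assert (Lt : forall (p : V3 -> R) r, p (X (phi s r) (psi s r)) = p (circle_point C s r)).
  { intros p r. rewrite HX by exact Hs; reflexivity. }
  exists (Au * fs + Av * gs), (Au * ft + Av * gt), (Bu * fs + Bv * gs), (Bu * ft + Bv * gt).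
  exists (pdu (cx X) u v * fs + pdv (cx X) u v * gs), (pdu (cx X) u v * ft + pdv (cx X) u v * gt).
  exists (pdu (cy X) u v * fs + pdv (cy X) u v * gs), (pdu (cy X) u v * ft + pdv (cy X) u v * gt).
  exists (pdu (cz X) u v * fs + pdv (cz X) u v * gs), (pdu (cz X) u v * ft + pdv (cz X) u v * gt).
  split; [apply DA; auto|]. split; [apply DA; auto|].
  split; [apply DB; auto|]. split; [apply DB; auto|].
  split; [apply (is_derive_ext_loc _ _ _ _ (Ls xc)); apply Dx; auto|].
  split; [apply (is_derive_ext _ _ _ _ (Lt xc)); apply Dx; auto|].
  split; [apply (is_derive_ext_loc _ _ _ _ (Ls yc)); apply Dy; auto|].
  split; [apply (is_derive_ext _ _ _ _ (Lt yc)); apply Dy; auto|].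
  split; [apply (is_derive_ext_loc _ _ _ _ (Ls zc)); apply Dz; auto|].
  split; [apply (is_derive_ext _ _ _ _ (Lt zc)); apply Dz; auto|].
  clear - E J H3.
  unfold slope_x, slope_y.
  assert (W : forall a b c, w1 X u v * a + w2 X u v * b + w3 X u v * c = 0 ->
     w1 X u v / w3 X u v * a + w2 X u v / w3 X u v * b + c = 0).
  { intros a b c H. transitivity ((w1 X u v * a + w2 X u v * b + w3 X u v * c) / w3 X u v);
      [field; exact H3|rewrite H; field; exact H3]. }
  split; [apply W; unfold w1, w2, w3; ring|].
  split; [apply W; unfold w1, w2, w3; ring|].
  split.
  - transitivity ((fs * gt - ft * gs) * (Au * pdv (cy X) u v - Av * pdu (cy X) u v
      + pdu (cx X) u v * Bv - pdv (cx X) u v * Bu)); [ring|rewrite E; ring].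
  - replace ((pdu (cx X) u v * fs + pdv (cx X) u v * gs) * (pdu (cy X) u v * ft + pdv (cy X) u v * gt) -
      (pdu (cx X) u v * ft + pdv (cx X) u v * gt) * (pdu (cy X) u v * fs + pdv (cy X) u v * gs))
     with (w3 X u v * (fs * gt - ft * gs)) by (unfold w3; ring).
    apply Rmult_integral_contrapositive_currified; assumption.
Qed.

(** * The jets of a circle family *)

Definition twice_derivable (J : R -> Prop) (f : R -> R) : Prop :=
  forall s, J s -> ex_derive f s /\ ex_derive (Derive f) s.

Lemma twice_derivable_mult (J : R -> Prop) (f g : R -> R) :
  open J -> twice_derivable J f -> twice_derivable J g ->
  twice_derivable J (fun s => f s * g s).
Proof.
  intros HJ Hf Hg s Hs.
  destruct (Hf s Hs) as [F1 F2], (Hg s Hs) as [G1 G2].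
  split; [apply (ex_derive_mult f g); assumption|].
  apply (ex_derive_ext_loc (fun s => Derive f s * g s + f s * Derive g s)).
  - generalize (HJ s Hs); apply filter_imp; intros r Hr. symmetry.
    apply Derive_mult; [apply Hf|apply Hg]; exact Hr.
  - apply (ex_derive_plus (fun s => Derive f s * g s) (fun s => f s * Derive g s)).
    + apply (ex_derive_mult (Derive f) g); assumption.
    + apply (ex_derive_mult f (Derive g)); assumption.
Qed.

Lemma smooth_twice_derivable (J : R -> Prop) (f : R -> R) :
  (forall s, J s -> forall n, ex_derive_n f n s) -> twice_derivable J f.
Proof. intros H s Hs. split; [exact (H s Hs 1%nat)|exact (H s Hs 2%nat)]. Qed.

Definition trig_derive (f : R -> trig) (s : R) : trig :=
  Trig (Derive (fun r => mean (f r)) s) (Derive (fun r => cosc (f r)) s)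
       (Derive (fun r => sinc (f r)) s).

Definition is_trig_derive (f : R -> trig) (s : R) (d : trig) : Prop :=
  is_derive (fun r => mean (f r)) s (mean d) /\
  is_derive (fun r => cosc (f r)) s (cosc d) /\
  is_derive (fun r => sinc (f r)) s (sinc d).

Definition circle_trig (C : circle_family) (p : V3 -> R) (s : R) : trig :=
  Trig (p (center C s)) (radius C s * p (e1 C s)) (radius C s * p (e2 C s)).

Definition circle_jet (C : circle_family) (p : V3 -> R) (s : R) : jet :=
  Jet (circle_trig C p s) (trig_derive (circle_trig C p) s)
      (trig_derive (trig_derive (circle_trig C p)) s).

Lemma circle_trig_derive C (p : V3 -> R) s :
  smooth_circle_family C -> index C s -> p = xc \/ p = yc \/ p = zc ->
  is_trig_derive (circle_trig C p) s (j1 (circle_jet C p s)) /\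
  is_trig_derive (trig_derive (circle_trig C p)) s (j2 (circle_jet C p s)).
Proof.
  intros (Hc & H1 & H2 & Hr & _) Hs Hp.
  assert (T : forall c, smooth_curve_on (index C) c -> twice_derivable (index C) (fun s => p (c s))).
  { intros c H. apply smooth_twice_derivable. intros r Hr' n.
    destruct (H r Hr' n) as (A & B & D). destruct Hp as [-> | [-> | ->]]; assumption. }
  apply smooth_twice_derivable in Hr.
  destruct (T _ Hc s Hs) as [C1 C2].
  destruct (twice_derivable_mult _ _ _ (open_index C) Hr (T _ H1) s Hs) as [A1 A2].
  destruct (twice_derivable_mult _ _ _ (open_index C) Hr (T _ H2) s Hs) as [B1 B2].
  repeat split; apply Derive_correct; assumption.
Qed.

Lemma circle_point_tev C (p : V3 -> R) s t : p = xc \/ p = yc \/ p = zc ->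
  p (circle_point C s t) = tev (circle_trig C p s) t.
Proof.
  intros Hp. unfold tev, circle_trig; cbn [mean cosc sinc].
  transitivity (p (center C s) + radius C s * (cos t * p (e1 C s) + sin t * p (e2 C s)));
    [destruct Hp as [-> | [-> | ->]]; reflexivity|ring].
Qed.

Lemma is_derive_tev_param f s d t :
  is_trig_derive f s d -> is_derive (fun r => tev (f r) t) s (tev d t).
Proof.
  intros (D1 & D2 & D3). unfold tev.
  apply (is_derive_plus (fun r => mean (f r) + cos t * cosc (f r)) (fun r => sin t * sinc (f r))).
  - apply (is_derive_plus (fun r => mean (f r)) (fun r => cos t * cosc (f r))); [exact D1|].
    apply is_derive_scal; exact D2.
  - apply is_derive_scal; exact D3.
Qed.

Lemma is_derive_tev g t : is_derive (tev g) t (tev (tdt g) t).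
Proof. unfold tev, tdt; cbn [mean cosc sinc]. auto_derive; [trivial|ring]. Qed.

Lemma is_trig_derive_tdt f s d :
  is_trig_derive f s d -> is_trig_derive (fun r => tdt (f r)) s (tdt d).
Proof.
  intros (D1 & D2 & D3). split; [|split]; cbn.
  - auto_derive; trivial.
  - exact D3.
  - apply (is_derive_opp (fun r => cosc (f r))); exact D2.
Qed.

Lemma is_derive_slope_relation (a b f g h : R -> R) (s a' b' f' g' h' : R) :
  is_derive a s a' -> is_derive b s b' -> is_derive f s f' -> is_derive g s g' ->
  is_derive h s h' -> locally s (fun r => a r * f r + b r * g r + h r = 0) ->
  a' * f s + a s * f' + (b' * g s + b s * g') + h' = 0.
Proof.
  intros Da Db Df Dg Dh L.
  assert (E : is_derive (fun r => a r * f r + b r * g r + h r) s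
    (a' * f s + a s * f' + (b' * g s + b s * g') + h')).
  { apply (is_derive_plus (fun r => a r * f r + b r * g r) h); [|exact Dh].
    apply (is_derive_plus (fun r => a r * f r) (fun r => b r * g r)).
    - apply (is_derive_mult a f); auto using Rmult_comm.
    - apply (is_derive_mult b g); auto using Rmult_comm. }
  apply (is_derive_ext_loc _ (fun _ => 0) _ _ L) in E.
  apply is_derive_unique in E. rewrite Derive_const in E. symmetry; exact E.
Qed.

Lemma foliation_minimal_jet U X C s :
  dirichlet_minimal_surface U X -> foliated_by U X C -> index C s ->
  minimal_jet (circle_jet C xc s) (circle_jet C yc s) (circle_jet C zc s).
Proof.
  intros minimal Hfol Hs t.
  destruct (foliation_slopes U X C minimal Hfol) as (A & B & H).
  destruct Hfol as [HC _].
  assert (Px : xc = xc \/ xc = yc \/ xc = zc) by tauto.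
  assert (Py : yc = xc \/ yc = yc \/ yc = zc) by tauto.
  assert (Pz : zc = xc \/ zc = yc \/ zc = zc) by tauto.
  assert (K : forall p r q, p = xc \/ p = yc \/ p = zc -> index C r ->
    is_derive (fun a => p (circle_point C a q)) r (tev (j1 (circle_jet C p r)) q) /\
    is_derive (fun a => p (circle_point C r a)) q (tev (tdt (circle_trig C p r)) q)).
  { intros p r q Hp Hr. split.
    - apply (is_derive_ext (fun a => tev (circle_trig C p a) q));
        [intros a; symmetry; apply circle_point_tev; exact Hp|].
      apply (is_derive_tev_param (circle_trig C p)).
      exact (proj1 (circle_trig_derive C p r HC Hr Hp)).
    - apply (is_derive_ext (tev (circle_trig C p r)));
        [intros a; symmetry; apply circle_point_tev; exact Hp|]. apply is_derive_tev. }
  assert (R : forall r q, index C r -> exists As At Bs Bt,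
    is_derive (fun a => A a q) r As /\ is_derive (fun a => A r a) q At /\
    is_derive (fun a => B a q) r Bs /\ is_derive (fun a => B r a) q Bt /\
    let xs := tev (j1 (circle_jet C xc r)) q in let xt := tev (tdt (circle_trig C xc r)) q in
    let ys := tev (j1 (circle_jet C yc r)) q in let yt := tev (tdt (circle_trig C yc r)) q in
    let zs := tev (j1 (circle_jet C zc r)) q in let zt := tev (tdt (circle_trig C zc r)) q in
    A r q * xs + B r q * ys + zs = 0 /\ A r q * xt + B r q * yt + zt = 0 /\
    As * yt - At * ys + xs * Bt - xt * Bs = 0 /\ xs * yt - xt * ys <> 0).
  { intros r q Hr.
    destruct (H r q Hr) as (As & At & Bs & Bt & xs & xt & ys & yt & zs & zt &
      D1 & D2 & D3 & D4 & X1 & X2 & Y1 & Y2 & Z1 & Z2 & E).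
    destruct (K xc r q Px Hr) as [X1' X2']. destruct (K yc r q Py Hr) as [Y1' Y2'].
    destruct (K zc r q Pz Hr) as [Z1' Z2'].
    exists As, At, Bs, Bt. do 4 (split; [assumption|]). cbv zeta.
    apply is_derive_unique in X1, X2, Y1, Y2, Z1, Z2, X1', X2', Y1', Y2', Z1', Z2'.
    rewrite <- X1', <- X2', <- Y1', <- Y2', <- Z1', <- Z2', X1, X2, Y1, Y2, Z1, Z2.
    exact E. }
  destruct (R s t Hs) as (As & At & Bs & Bt & DAs & DAt & DBs & DBt & E1 & E2 & E3 & E4).
  exists (A s t), (B s t), As, At, Bs, Bt. cbv zeta.
  pose proof (fun p Hp => circle_trig_derive C p s HC Hs Hp) as T.
  split; [exact E1|]. split; [exact E2|].
  (* The remaining first-order equations are the two tangency relations differentiated in [s] and in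
     [t]. In [s] they hold only inside the index interval, hence near [s]; in [t] they hold
     everywhere. *)
  assert (L1 : locally s (fun r => A r t * tev (j1 (circle_jet C xc r)) t
     + B r t * tev (j1 (circle_jet C yc r)) t + tev (j1 (circle_jet C zc r)) t = 0)).
  { generalize (index_locally C s Hs); apply filter_imp; intros r Hr.
    destruct (R r t Hr) as (? & ? & ? & ? & _ & _ & _ & _ & E & _); exact E. }
  assert (L2 : locally s (fun r => A r t * tev (tdt (circle_trig C xc r)) t
     + B r t * tev (tdt (circle_trig C yc r)) t + tev (tdt (circle_trig C zc r)) t = 0)).
  { generalize (index_locally C s Hs); apply filter_imp; intros r Hr.
    destruct (R r t Hr) as (? & ? & ? & ? & _ & _ & _ & _ & _ & E & _); exact E. }
  assert (L3 : locally t (fun q => A s q * tev (j1 (circle_jet C xc s)) q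
     + B s q * tev (j1 (circle_jet C yc s)) q + tev (j1 (circle_jet C zc s)) q = 0)).
  { apply filter_forall; intros q.
    destruct (R s q Hs) as (? & ? & ? & ? & _ & _ & _ & _ & E & _); exact E. }
  assert (L4 : locally t (fun q => A s q * tev (tdt (circle_trig C xc s)) q
     + B s q * tev (tdt (circle_trig C yc s)) q + tev (tdt (circle_trig C zc s)) q = 0)).
  { apply filter_forall; intros q.
    destruct (R s q Hs) as (? & ? & ? & ? & _ & _ & _ & _ & _ & E & _); exact E. }
  split; [apply (is_derive_slope_relation _ _ _ _ _ s _ _ _ _ _) with (6 := L1);
    try assumption; apply (is_derive_tev_param (trig_derive _)), (fun p Hp => proj2 (T p Hp));
    assumption|].
  split; [apply (is_derive_slope_relation _ _ _ _ _ t _ _ _ _ _) with (6 := L3);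
    try assumption; apply is_derive_tev|].
  split; [apply (is_derive_slope_relation _ _ _ _ _ s _ _ _ _ _) with (6 := L2);
    try assumption;
    apply (is_derive_tev_param (fun r => tdt (circle_trig C _ r))), (is_trig_derive_tdt (circle_trig C _)),
      (fun p Hp => proj1 (T p Hp)); assumption|].
  split; [apply (is_derive_slope_relation _ _ _ _ _ t _ _ _ _ _) with (6 := L4);
    try assumption; apply is_derive_tev|].
  split; [exact E3|exact E4].
Qed.

(** * The planes of the foliation *)

Definition is_vec_derive (a : R -> V3) (s : R) (d : V3) : Prop :=
  is_derive (fun r => xc (a r)) s (xc d) /\ is_derive (fun r => yc (a r)) s (yc d) /\
  is_derive (fun r => zc (a r)) s (zc d).

Lemma is_derive_dot a b s a' b' :
  is_vec_derive a s a' -> is_vec_derive b s b' ->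
  is_derive (fun r => dot (a r) (b r)) s (dot a' (b s) + dot (a s) b').
Proof.
  intros (A1 & A2 & A3) (B1 & B2 & B3). unfold dot.
  replace (xc a' * xc (b s) + yc a' * yc (b s) + zc a' * zc (b s) +
     (xc (a s) * xc b' + yc (a s) * yc b' + zc (a s) * zc b'))
    with ((xc a' * xc (b s) + xc (a s) * xc b') + (yc a' * yc (b s) + yc (a s) * yc b')
          + (zc a' * zc (b s) + zc (a s) * zc b')) by ring.
  apply (is_derive_plus (fun r => xc (a r) * xc (b r) + yc (a r) * yc (b r))
                        (fun r => zc (a r) * zc (b r))).
  - apply (is_derive_plus (fun r => xc (a r) * xc (b r)) (fun r => yc (a r) * yc (b r))).
    + apply (is_derive_mult (fun r => xc (a r)) (fun r => xc (b r))); auto using Rmult_comm.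
    + apply (is_derive_mult (fun r => yc (a r)) (fun r => yc (b r))); auto using Rmult_comm.
  - apply (is_derive_mult (fun r => zc (a r)) (fun r => zc (b r))); auto using Rmult_comm.
Qed.

Lemma is_vec_derive_const (n : V3) s : is_vec_derive (fun _ => n) s (0, 0, 0).
Proof. split; [|split]; exact (is_derive_const _ s). Qed.

Lemma is_derive_minor (f g h k : R -> R) s f' g' h' k' :
  is_derive f s f' -> is_derive g s g' -> is_derive h s h' -> is_derive k s k' ->
  is_derive (fun r => f r * g r - h r * k r) s
    ((f' * g s - h' * k s) + (f s * g' - h s * k')).
Proof.
  intros F G H K.
  replace ((f' * g s - h' * k s) + (f s * g' - h s * k'))
    with ((f' * g s + f s * g') - (h' * k s + h s * k')) by ring.
  apply (is_derive_minus (fun r => f r * g r) (fun r => h r * k r)).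
  - apply (is_derive_mult f g); auto using Rmult_comm.
  - apply (is_derive_mult h k); auto using Rmult_comm.
Qed.

Lemma is_vec_derive_cross a b s a' b' :
  is_vec_derive a s a' -> is_vec_derive b s b' ->
  is_vec_derive (fun r => cross (a r) (b r)) s (plus (cross a' (b s)) (cross (a s) b')).
Proof.
  intros (A1 & A2 & A3) (B1 & B2 & B3).
  split; [|split].
  - apply (is_derive_minor (fun r => yc (a r)) (fun r => zc (b r))
                           (fun r => zc (a r)) (fun r => yc (b r))); assumption.
  - apply (is_derive_minor (fun r => zc (a r)) (fun r => xc (b r))
                           (fun r => xc (a r)) (fun r => zc (b r))); assumption.
  - apply (is_derive_minor (fun r => xc (a r)) (fun r => yc (b r))
                           (fun r => yc (a r)) (fun r => xc (b r))); assumption.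
Qed.

Lemma is_vec_derive_trig x y z s dx dy dz :
  is_trig_derive x s dx -> is_trig_derive y s dy -> is_trig_derive z s dz ->
  is_vec_derive (fun r => meanv (x r) (y r) (z r)) s (meanv dx dy dz) /\
  is_vec_derive (fun r => cosv (x r) (y r) (z r)) s (cosv dx dy dz) /\
  is_vec_derive (fun r => sinv (x r) (y r) (z r)) s (sinv dx dy dz).
Proof.
  intros (X1 & X2 & X3) (Y1 & Y2 & Y3) (Z1 & Z2 & Z3).
  split; [|split]; (split; [|split]); assumption.
Qed.

Definition center_vec C s := meanv (circle_trig C xc s) (circle_trig C yc s) (circle_trig C zc s).
Definition cos_vec C s := cosv (circle_trig C xc s) (circle_trig C yc s) (circle_trig C zc s).
Definition sin_vec C s := sinv (circle_trig C xc s) (circle_trig C yc s) (circle_trig C zc s).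
Definition center_vec' C s := meanv (j1 (circle_jet C xc s)) (j1 (circle_jet C yc s)) (j1 (circle_jet C zc s)).
Definition cos_vec' C s := cosv (j1 (circle_jet C xc s)) (j1 (circle_jet C yc s)) (j1 (circle_jet C zc s)).
Definition sin_vec' C s := sinv (j1 (circle_jet C xc s)) (j1 (circle_jet C yc s)) (j1 (circle_jet C zc s)).
Definition cos_vec'' C s := cosv (j2 (circle_jet C xc s)) (j2 (circle_jet C yc s)) (j2 (circle_jet C zc s)).
Definition sin_vec'' C s := sinv (j2 (circle_jet C xc s)) (j2 (circle_jet C yc s)) (j2 (circle_jet C zc s)).

Lemma circle_vectors_derive C s : smooth_circle_family C -> index C s ->
  is_vec_derive (center_vec C) s (center_vec' C s) /\
  is_vec_derive (cos_vec C) s (cos_vec' C s) /\ is_vec_derive (sin_vec C) s (sin_vec' C s) /\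
  is_vec_derive (cos_vec' C) s (cos_vec'' C s) /\ is_vec_derive (sin_vec' C) s (sin_vec'' C s).
Proof.
  intros HC Hs.
  destruct (circle_trig_derive C xc s HC Hs ltac:(tauto)) as [X1 X2].
  destruct (circle_trig_derive C yc s HC Hs ltac:(tauto)) as [Y1 Y2].
  destruct (circle_trig_derive C zc s HC Hs ltac:(tauto)) as [Z1 Z2].
  destruct (is_vec_derive_trig _ _ _ _ _ _ _ X1 Y1 Z1) as (P1 & P2 & P3).
  destruct (is_vec_derive_trig _ _ _ _ _ _ _ X2 Y2 Z2) as (_ & Q2 & Q3).
  split; [exact P1|]. split; [exact P2|]. split; [exact P3|].
  split; [exact Q2|exact Q3].
Qed.

Lemma circle_orthogonality C s : smooth_circle_family C -> index C s ->
  0 < dot (cos_vec C s) (cos_vec C s) /\ dot (cos_vec C s) (cos_vec C s) = dot (sin_vec C s) (sin_vec C s) /\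
  dot (cos_vec C s) (sin_vec C s) = 0.
Proof.
  intros (_ & _ & _ & _ & H) Hs. destruct (H s Hs) as (Hr & H1 & H2 & H3).
  assert (E1 : dot (cos_vec C s) (cos_vec C s) = radius C s * radius C s * dot (e1 C s) (e1 C s))
    by (unfold dot, cos_vec, cosv, circle_trig, xc, yc, zc; simpl; ring).
  assert (E2 : dot (sin_vec C s) (sin_vec C s) = radius C s * radius C s * dot (e2 C s) (e2 C s))
    by (unfold dot, sin_vec, sinv, circle_trig, xc, yc, zc; simpl; ring).
  assert (E3 : dot (cos_vec C s) (sin_vec C s) = radius C s * radius C s * dot (e1 C s) (e2 C s))
    by (unfold dot, cos_vec, sin_vec, cosv, sinv, circle_trig, xc, yc, zc; simpl; ring).
  rewrite E1, E2, E3, H1, H2, H3.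
  pose proof (Rmult_lt_0_compat _ _ Hr Hr). repeat split; lra.
Qed.

Lemma circle_relations C s : smooth_circle_family C -> index C s ->
  0 < dot (cos_vec C s) (cos_vec C s) /\
  dot (cos_vec C s) (cos_vec C s) = dot (sin_vec C s) (sin_vec C s) /\ dot (cos_vec C s) (sin_vec C s) = 0 /\
  dot (cos_vec C s) (cos_vec' C s) = dot (sin_vec C s) (sin_vec' C s) /\
  dot (cos_vec C s) (sin_vec' C s) + dot (cos_vec' C s) (sin_vec C s) = 0 /\
  dot (cos_vec' C s) (cos_vec' C s) + dot (cos_vec C s) (cos_vec'' C s)
    = dot (sin_vec' C s) (sin_vec' C s) + dot (sin_vec C s) (sin_vec'' C s) /\
  dot (cos_vec C s) (sin_vec'' C s) + 2 * dot (cos_vec' C s) (sin_vec' C s) + dot (cos_vec'' C s) (sin_vec C s) = 0.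
Proof.
  intros HC Hs.
  destruct (circle_orthogonality C s HC Hs) as (O1 & O2 & O3).
  split; [exact O1|]. split; [exact O2|]. split; [exact O3|].
  assert (sym : forall u v, dot u v = dot v u) by (intros; unfold dot; ring).
  (* The first-order relations are proved at every index, so that they can be differentiated once
     more at [s]. *)
  assert (F : forall r, index C r ->
    dot (cos_vec C r) (cos_vec' C r) = dot (sin_vec C r) (sin_vec' C r) /\
    dot (cos_vec C r) (sin_vec' C r) + dot (cos_vec' C r) (sin_vec C r) = 0).
  { intros r Hr. destruct (circle_vectors_derive C r HC Hr) as (_ & Da & Db & _ & _).
    pose proof (is_derive_eq_on_index C _ _ r _ _ Hr
      (fun q Hq => proj1 (proj2 (circle_orthogonality C q HC Hq)))
      (is_derive_dot _ _ _ _ _ Da Da) (is_derive_dot _ _ _ _ _ Db Db)) as E1.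
    pose proof (is_derive_eq_on_index C _ (fun _ => 0) r _ 0 Hr
      (fun q Hq => proj2 (proj2 (circle_orthogonality C q HC Hq)))
      (is_derive_dot _ _ _ _ _ Da Db) (is_derive_const 0 r)) as E2.
    rewrite (sym (cos_vec' C r) (cos_vec C r)), (sym (sin_vec' C r) (sin_vec C r)) in E1. split; lra. }
  destruct (F s Hs) as [F1 F2]. split; [exact F1|]. split; [exact F2|].
  destruct (circle_vectors_derive C s HC Hs) as (_ & Da & Db & Da1 & Db1).
  pose proof (is_derive_eq_on_index C _ _ s _ _ Hs (fun q Hq => proj1 (F q Hq))
      (is_derive_dot _ _ _ _ _ Da Da1) (is_derive_dot _ _ _ _ _ Db Db1)) as E1.
  pose proof (is_derive_eq_on_index C _ (fun _ => 0) s _ 0 Hs (fun q Hq => proj2 (F q Hq))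
      (is_derive_plus (fun r => dot (cos_vec C r) (sin_vec' C r)) (fun r => dot (cos_vec' C r) (sin_vec C r)) s _ _
        (is_derive_dot _ _ _ _ _ Da Db1) (is_derive_dot _ _ _ _ _ Da1 Db))
      (is_derive_const 0 s)) as E2.
  unfold plus in E2; simpl in E2. split; lra.
Qed.

Lemma circle_jet_circular C s : smooth_circle_family C -> index C s ->
  circular_jet (circle_jet C xc s) (circle_jet C yc s) (circle_jet C zc s).
Proof. exact (circle_relations C s). Qed.

Lemma circle_alternative U X C s :
  dirichlet_minimal_surface U X -> foliated_by U X C -> index C s ->
  (zc (cos_vec C s) = 0 /\ zc (sin_vec C s) = 0) \/
  (dot (cos_vec' C s) (cos_vec' C s) = dot (sin_vec' C s) (sin_vec' C s) /\ dot (cos_vec' C s) (sin_vec' C s) = 0 /\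
   dot (cross (cos_vec C s) (sin_vec C s)) (cos_vec' C s) = 0 /\
   dot (cross (cos_vec C s) (sin_vec C s)) (sin_vec' C s) = 0).
Proof.
  intros minimal Hfol Hs.
  exact (minimal_circles_alternative _ _ _
    (foliation_minimal_jet U X C s minimal Hfol Hs)
    (circle_jet_circular C s (proj1 Hfol) Hs)).
Qed.

Lemma cross_length (a b : V3) : dot a a = dot b b -> dot a b = 0 ->
  dot (cross a b) (cross a b) = dot a a * dot a a.
Proof.
  intros E O.
  transitivity (dot a a * dot b b - dot a b * dot a b);
    [unfold dot, cross, xc, yc, zc; simpl; ring|rewrite O, <- E; ring].
Qed.

(** In complex form, [V' = (l + i m) V]: [l] is the logarithmic derivative of the radius and [m] the
    speed of rotation of the frame in its plane. *)
Lemma rotating_frame (a b a' b' : V3) :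
  0 < dot a a -> dot a a = dot b b -> dot a b = 0 ->
  dot a a' = dot b b' -> dot a b' + dot a' b = 0 ->
  dot (cross a b) a' = 0 -> dot (cross a b) b' = 0 ->
  exists l m,
    a' = (l * xc a + m * xc b, l * yc a + m * yc b, l * zc a + m * zc b) /\
    b' = (- m * xc a + l * xc b, - m * yc a + l * yc b, - m * zc a + l * zc b).
Proof.
  intros H0 H1 H2 H3 H4 Na Nb.
  assert (Hn : 0 < dot (cross a b) (cross a b)).
  { rewrite cross_length by assumption. apply Rmult_lt_0_compat; assumption. }
  assert (Oa : dot (cross a b) a = 0) by (unfold dot, cross, xc, yc, zc; simpl; ring).
  assert (Ob : dot (cross a b) b = 0) by (unfold dot, cross, xc, yc, zc; simpl; ring).
  destruct (orthogonal_span a b _ a' H0 H1 H2 Hn Oa Ob Na) as (Xa & Ya & Za).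
  destruct (orthogonal_span a b _ b' H0 H1 H2 Hn Oa Ob Nb) as (Xb & Yb & Zb).
  exists (dot a a' / dot a a), (dot b a' / dot a a). split.
  - destruct a' as [[u v] w]. rewrite <- Xa, <- Ya, <- Za. reflexivity.
  - replace (- (dot b a' / dot a a)) with (dot a b' / dot a a)
      by (replace (dot b a') with (dot a' b) by (unfold dot; ring);
          replace (dot a b') with (- dot a' b) by lra; field; lra).
    rewrite H3. destruct b' as [[u v] w]. rewrite <- Xb, <- Yb, <- Zb. reflexivity.
Qed.

(** * Constancy of the tilt and of the normal *)

Lemma is_derive_quotient_zero (f g : R -> R) s f' g' :
  is_derive f s f' -> is_derive g s g' -> g s <> 0 -> f' * g s = f s * g' ->
  is_derive (fun r => f r / g r) s 0.
Proof.
  intros Df Dg N E.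
  replace 0 with ((f' * g s - f s * g') / g s ^ 2) by (rewrite E; field; exact N).
  apply is_derive_div; assumption.
Qed.

(* The squared sine of the angle between the plane of a circle and the horizontal. *)
Definition tilt C s : R :=
  (zc (cos_vec C s) * zc (cos_vec C s) + zc (sin_vec C s) * zc (sin_vec C s)) / dot (cos_vec C s) (cos_vec C s).

(** For a horizontal circle the numerator, quadratic in the two heights, vanishes together with its
    derivative. Otherwise differentiation multiplies numerator and denominator by the same factor
    [2 l]. *)
Lemma tilt_constant U X C s1 s2 :
  dirichlet_minimal_surface U X -> foliated_by U X C -> index C s1 -> index C s2 ->
  tilt C s1 = tilt C s2.
Proof.
  intros minimal Hfol. apply constant_on_index. intros s Hs.
  pose proof (proj1 Hfol) as HC.
  destruct (circle_vectors_derive C s HC Hs) as (_ & Da & Db & _ & _).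
  destruct (circle_relations C s HC Hs) as (O1 & O2 & O3 & O4 & O5 & _).
  pose proof Da as (_ & _ & Dza). pose proof Db as (_ & _ & Dzb).
  apply (is_derive_quotient_zero
    (fun r => zc (cos_vec C r) * zc (cos_vec C r) + zc (sin_vec C r) * zc (sin_vec C r))
    (fun r => dot (cos_vec C r) (cos_vec C r)) s
    ((zc (cos_vec' C s) * zc (cos_vec C s) + zc (cos_vec C s) * zc (cos_vec' C s))
     + (zc (sin_vec' C s) * zc (sin_vec C s) + zc (sin_vec C s) * zc (sin_vec' C s)))
    (dot (cos_vec' C s) (cos_vec C s) + dot (cos_vec C s) (cos_vec' C s))).
  - apply (is_derive_plus (fun r => zc (cos_vec C r) * zc (cos_vec C r)) (fun r => zc (sin_vec C r) * zc (sin_vec C r))).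
    + apply (is_derive_mult (fun r => zc (cos_vec C r)) (fun r => zc (cos_vec C r))); auto using Rmult_comm.
    + apply (is_derive_mult (fun r => zc (sin_vec C r)) (fun r => zc (sin_vec C r))); auto using Rmult_comm.
  - apply is_derive_dot; assumption.
  - apply Rgt_not_eq; exact O1.
  - destruct (circle_alternative U X C s minimal Hfol Hs) as [[Za Zb]|(_ & _ & Na & Nb)].
    + rewrite Za, Zb; ring.
    + destruct (rotating_frame _ _ _ _ O1 O2 O3 O4 O5 Na Nb) as (l & m & Ea & Eb).
      assert (Za : zc (cos_vec' C s) = l * zc (cos_vec C s) + m * zc (sin_vec C s)) by (rewrite Ea; reflexivity).
      assert (Zb : zc (sin_vec' C s) = - m * zc (cos_vec C s) + l * zc (sin_vec C s)) by (rewrite Eb; reflexivity).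
      assert (D : dot (cos_vec C s) (cos_vec' C s) = l * dot (cos_vec C s) (cos_vec C s)).
      { transitivity (l * dot (cos_vec C s) (cos_vec C s) + m * dot (cos_vec C s) (sin_vec C s));
          [rewrite Ea; unfold dot at 1; unfold dot, xc, yc, zc; cbn [fst snd]; ring
          |rewrite O3; ring]. }
      replace (dot (cos_vec' C s) (cos_vec C s)) with (dot (cos_vec C s) (cos_vec' C s)) by (unfold dot; ring).
      rewrite Za, Zb, D; ring.
Qed.

(** A nonzero tilt excludes the first alternative, and then [a x b] and [a.a] are both multiplied by
    [2 l] under differentiation. *)
Lemma normal_constant U X C s1 s2 :
  dirichlet_minimal_surface U X -> foliated_by U X C ->
  (forall s, index C s -> tilt C s <> 0) -> index C s1 -> index C s2 ->
  forall p, p = xc \/ p = yc \/ p = zc ->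
  p (cross (cos_vec C s1) (sin_vec C s1)) / dot (cos_vec C s1) (cos_vec C s1) =
  p (cross (cos_vec C s2) (sin_vec C s2)) / dot (cos_vec C s2) (cos_vec C s2).
Proof.
  intros minimal Hfol Ht H1 H2 p Hp.
  apply (constant_on_index C (fun s =>
    p (cross (cos_vec C s) (sin_vec C s)) / dot (cos_vec C s) (cos_vec C s))); [|exact H1|exact H2].
  intros s Hs.
  pose proof (proj1 Hfol) as HC.
  destruct (circle_vectors_derive C s HC Hs) as (_ & Da & Db & _ & _).
  destruct (circle_relations C s HC Hs) as (O1 & O2 & O3 & O4 & O5 & _).
  destruct (circle_alternative U X C s minimal Hfol Hs) as [[Za Zb]|(_ & _ & Na & Nb)].
  { exfalso. apply (Ht s Hs). unfold tilt; rewrite Za, Zb; field; lra. }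
  destruct (rotating_frame _ _ _ _ O1 O2 O3 O4 O5 Na Nb) as (l & m & Ea & Eb).
  assert (D : dot (cos_vec C s) (cos_vec' C s) = l * dot (cos_vec C s) (cos_vec C s)).
  { transitivity (l * dot (cos_vec C s) (cos_vec C s) + m * dot (cos_vec C s) (sin_vec C s));
      [rewrite Ea; unfold dot at 1; unfold dot, xc, yc, zc; cbn [fst snd]; ring
      |rewrite O3; ring]. }
  pose proof (is_vec_derive_cross _ _ _ _ _ Da Db) as (Dx & Dy & Dz).
  set (N' := plus (cross (cos_vec' C s) (sin_vec C s)) (cross (cos_vec C s) (sin_vec' C s))) in *.
  assert (EN : xc N' = 2 * l * xc (cross (cos_vec C s) (sin_vec C s)) /\
               yc N' = 2 * l * yc (cross (cos_vec C s) (sin_vec C s)) /\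
               zc N' = 2 * l * zc (cross (cos_vec C s) (sin_vec C s))).
  { unfold N'. rewrite Ea, Eb. destruct (cos_vec C s) as [[u1 u2] u3], (sin_vec C s) as [[v1 v2] v3].
    repeat split; unfold cross, plus, xc, yc, zc; simpl; unfold plus; simpl; ring. }
  destruct EN as (EX & EY & EZ).
  apply (is_derive_quotient_zero (fun r => p (cross (cos_vec C r) (sin_vec C r)))
    (fun r => dot (cos_vec C r) (cos_vec C r)) s (p N') (dot (cos_vec' C s) (cos_vec C s) + dot (cos_vec C s) (cos_vec' C s))).
  - destruct Hp as [-> | [-> | ->]]; assumption.
  - apply is_derive_dot; assumption.
  - apply Rgt_not_eq; exact O1.
  - replace (dot (cos_vec' C s) (cos_vec C s)) with (dot (cos_vec C s) (cos_vec' C s)) by (unfold dot; ring).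
    rewrite D. destruct Hp as [-> | [-> | ->]]; rewrite ?EX, ?EY, ?EZ; ring.
Qed.

Lemma tilted_circles_planar U X C s0 :
  dirichlet_minimal_surface U X -> foliated_by U X C ->
  index C s0 -> tilt C s0 <> 0 -> planar U X.
Proof.
  intros minimal Hfol Hs0 Ht0.
  pose proof (proj1 Hfol) as HC.
  assert (Ht : forall s, index C s -> tilt C s <> 0).
  { intros s Hs. rewrite (tilt_constant U X C s s0 minimal Hfol Hs Hs0). exact Ht0. }
  set (q := dot (cos_vec C s0) (cos_vec C s0)).
  set (N := cross (cos_vec C s0) (sin_vec C s0)).
  set (n := (xc N / q, yc N / q, zc N / q)).
  (* [n], built at [s0], is the unit normal of every circle; this transfers the relations on [a x b]
     to [n]. *)
  assert (En : forall s v, index C s ->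
    dot n v = dot (cross (cos_vec C s) (sin_vec C s)) v / dot (cos_vec C s) (cos_vec C s)).
  { intros s v Hs.
    pose proof (normal_constant U X C s0 s minimal Hfol Ht Hs0 Hs) as K.
    pose proof (K xc ltac:(tauto)) as Kx. pose proof (K yc ltac:(tauto)) as Ky.
    pose proof (K zc ltac:(tauto)) as Kz. fold N q in Kx, Ky, Kz.
    set (M := cross (cos_vec C s) (sin_vec C s)) in *. set (r := dot (cos_vec C s) (cos_vec C s)) in *.
    transitivity (xc N / q * xc v + yc N / q * yc v + zc N / q * zc v); [reflexivity|].
    rewrite Kx, Ky, Kz. unfold Rdiv, dot. ring. }
  assert (Hn : 0 < dot n n).
  { destruct (circle_orthogonality C s0 HC Hs0) as (O1 & O2 & O3). fold q in O1.
    assert (E : dot N N = q * q) by (apply cross_length; assumption).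
    replace (dot n n) with (dot N N / (q * q))
      by (unfold dot, n, xc, yc, zc; cbn [fst snd]; field; lra).
    rewrite E. replace (q * q / (q * q)) with 1 by (field; lra). lra. }
  assert (F : forall s, index C s ->
    dot (cos_vec' C s) (cos_vec' C s) = dot (sin_vec' C s) (sin_vec' C s) /\ dot (cos_vec' C s) (sin_vec' C s) = 0 /\
    dot n (cos_vec C s) = 0 /\ dot n (sin_vec C s) = 0 /\ dot n (cos_vec' C s) = 0 /\ dot n (sin_vec' C s) = 0).
  { intros s Hs.
    destruct (circle_orthogonality C s HC Hs) as (O1 & _ & _).
    destruct (circle_alternative U X C s minimal Hfol Hs) as [[Za Zb]|(G1 & G2 & Na & Nb)].
    { exfalso. apply (Ht s Hs). unfold tilt; rewrite Za, Zb; field; lra. }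
    split; [exact G1|]. split; [exact G2|].
    rewrite !(En s) by exact Hs. rewrite Na, Nb.
    replace (dot (cross (cos_vec C s) (sin_vec C s)) (cos_vec C s)) with 0
      by (unfold dot, cross, xc, yc, zc; simpl; ring).
    replace (dot (cross (cos_vec C s) (sin_vec C s)) (sin_vec C s)) with 0
      by (unfold dot, cross, xc, yc, zc; simpl; ring).
    repeat split; field; lra. }
  assert (Z0 : forall v, dot (0, 0, 0) v = 0)
    by (intros v; unfold dot, xc at 1, yc at 1, zc at 1; simpl; ring).
  assert (Hc : forall s, index C s -> dot n (center_vec' C s) = 0).
  { intros s Hs. destruct (F s Hs) as (G1 & G2 & Na & Nb & Na1 & Nb1).
    destruct (circle_vectors_derive C s HC Hs) as (_ & _ & _ & Da1 & Db1).
    destruct (circle_orthogonality C s HC Hs) as (O1 & _ & _).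
    (* Since [n] is constant, differentiating [n.a' = 0] and [n.b' = 0] gives [n.a'' = 0] and
       [n.b'' = 0]. *)
    pose proof (is_derive_eq_on_index C _ (fun _ => 0) s _ 0 Hs
      (fun r Hr => proj1 (proj2 (proj2 (proj2 (proj2 (F r Hr))))))
      (is_derive_dot (fun _ => n) _ _ _ _ (is_vec_derive_const n s) Da1) (is_derive_const 0 s)) as Na2.
    pose proof (is_derive_eq_on_index C _ (fun _ => 0) s _ 0 Hs
      (fun r Hr => proj2 (proj2 (proj2 (proj2 (proj2 (F r Hr))))))
      (is_derive_dot (fun _ => n) _ _ _ _ (is_vec_derive_const n s) Db1) (is_derive_const 0 s)) as Nb2.
    rewrite Z0, Rplus_0_l in Na2, Nb2.
    apply (tilted_parallel_circles _ _ _ n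
      (foliation_minimal_jet U X C s minimal Hfol Hs) (circle_jet_circular C s HC Hs));
      try assumption.
    intros [Za Zb]. change (zc (cos_vec C s) = 0) in Za. change (zc (sin_vec C s) = 0) in Zb.
    apply (Ht s Hs). unfold tilt; rewrite Za, Zb; field; lra. }
  exists (fun v => dot (minus v (center_vec C s0)) n = 0). split.
  { exists (center_vec C s0), n. split; [|intros v; reflexivity].
    intros E. rewrite E in Hn. unfold zero3 in Hn. rewrite Z0 in Hn. lra. }
  intros u v Huv. destruct Hfol as (_ & phi & psi & _ & _ & _ & Hon & _ & _ & HX).
  destruct (Hon u v Huv) as (s & t & Hs & <- & <-).
  rewrite (HX s t Hs).
  assert (Ec : dot n (center_vec C s) = dot n (center_vec C s0)).
  { apply (constant_on_index C (fun r => dot n (center_vec C r))); [|exact Hs|exact Hs0].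
    intros r Hr. destruct (circle_vectors_derive C r HC Hr) as (Dc & _).
    rewrite <- (Hc r Hr), <- (Rplus_0_l (dot n (center_vec' C r))), <- (Z0 (center_vec C r)).
    apply (is_derive_dot (fun _ => n) (center_vec C)); [apply is_vec_derive_const|exact Dc]. }
  destruct (F s Hs) as (_ & _ & Na & Nb & _).
  transitivity (dot n (center_vec C s) - dot n (center_vec C s0) + cos t * dot n (cos_vec C s) + sin t * dot n (sin_vec C s)).
  - pose proof (circle_point_tev C xc s t ltac:(tauto)) as Px.
    pose proof (circle_point_tev C yc s t ltac:(tauto)) as Py.
    pose proof (circle_point_tev C zc s t ltac:(tauto)) as Pz.
    transitivity ((xc (circle_point C s t) - xc (center_vec C s0)) * xc n
      + (yc (circle_point C s t) - yc (center_vec C s0)) * yc n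
      + (zc (circle_point C s t) - zc (center_vec C s0)) * zc n); [reflexivity|].
    rewrite Px, Py, Pz. unfold tev, dot.
    change (xc (cos_vec C s)) with (cosc (circle_trig C xc s)).
    change (yc (cos_vec C s)) with (cosc (circle_trig C yc s)).
    change (zc (cos_vec C s)) with (cosc (circle_trig C zc s)).
    change (xc (sin_vec C s)) with (sinc (circle_trig C xc s)).
    change (yc (sin_vec C s)) with (sinc (circle_trig C yc s)).
    change (zc (sin_vec C s)) with (sinc (circle_trig C zc s)).
    change (xc (center_vec C s)) with (mean (circle_trig C xc s)).
    change (yc (center_vec C s)) with (mean (circle_trig C yc s)).
    change (zc (center_vec C s)) with (mean (circle_trig C zc s)).
    ring.
  - rewrite Ec, Na, Nb; ring.
Qed.

(** A normal of [P] is orthogonal to the two radius vectors, which are horizontal and independent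
    here, so it is vertical. *)
Lemma horizontal_circle_plane C s (P : V3 -> Prop) :
  smooth_circle_family C -> index C s -> tilt C s = 0 ->
  is_plane P -> (forall t, P (circle_point C s t)) -> parallel P xy_plane.
Proof.
  intros HC Hs Ht (p & n & Hn & HP) Hc.
  destruct (circle_orthogonality C s HC Hs) as (O1 & O2 & O3).
  assert (Z : zc (cos_vec C s) = 0 /\ zc (sin_vec C s) = 0).
  { apply sum_squares_zero. unfold tilt in Ht.
    apply Rmult_integral in Ht. destruct Ht as [Ht|Ht]; [exact Ht|].
    apply Rinv_neq_0_compat in Ht; [contradiction|lra]. }
  destruct Z as [Za Zb].
  assert (E : forall t, dot (minus (center_vec C s) p) n + cos t * dot n (cos_vec C s)
                        + sin t * dot n (sin_vec C s) = 0).
  { intros t. rewrite <- (proj1 (HP _) (Hc t)).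
    pose proof (circle_point_tev C xc s t ltac:(tauto)) as Px.
    pose proof (circle_point_tev C yc s t ltac:(tauto)) as Py.
    pose proof (circle_point_tev C zc s t ltac:(tauto)) as Pz.
    transitivity ((xc (circle_point C s t) - xc p) * xc n
      + (yc (circle_point C s t) - yc p) * yc n
      + (zc (circle_point C s t) - zc p) * zc n); [|reflexivity].
    rewrite Px, Py, Pz. unfold tev, dot.
    change (xc (cos_vec C s)) with (cosc (circle_trig C xc s)).
    change (yc (cos_vec C s)) with (cosc (circle_trig C yc s)).
    change (zc (cos_vec C s)) with (cosc (circle_trig C zc s)).
    change (xc (sin_vec C s)) with (sinc (circle_trig C xc s)).
    change (yc (sin_vec C s)) with (sinc (circle_trig C yc s)).
    change (zc (sin_vec C s)) with (sinc (circle_trig C zc s)).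
    change (xc (minus (center_vec C s) p)) with (mean (circle_trig C xc s) - xc p).
    change (yc (minus (center_vec C s) p)) with (mean (circle_trig C yc s) - yc p).
    change (zc (minus (center_vec C s) p)) with (mean (circle_trig C zc s) - zc p).
    ring. }
  (* The values at [0], [PI] and [PI / 2] separate the constant, cosine and sine coefficients. *)
  pose proof (E 0) as E0. pose proof (E PI) as E1. pose proof (E (PI / 2)) as E2.
  rewrite cos_0, sin_0 in E0. rewrite cos_PI, sin_PI in E1. rewrite cos_PI2, sin_PI2 in E2.
  assert (Na : dot n (cos_vec C s) = 0) by lra. assert (Nb : dot n (sin_vec C s) = 0) by lra.
  clear E E0 E1 E2.
  assert (N12 : xc n = 0 /\ yc n = 0).
  { unfold dot in *. rewrite Za, Zb in *.
    set (u1 := xc (cos_vec C s)) in *; set (u2 := yc (cos_vec C s)) in *.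
    set (v1 := xc (sin_vec C s)) in *; set (v2 := yc (sin_vec C s)) in *.
    assert (D : (u1 * v2 - u2 * v1) <> 0).
    { intros D.
      assert (L : (u1 * u1 + u2 * u2) * (v1 * v1 + v2 * v2) =
        (u1 * v1 + u2 * v2) * (u1 * v1 + u2 * v2) + (u1 * v2 - u2 * v1) * (u1 * v2 - u2 * v1)) by ring.
      replace (u1 * v1 + u2 * v2) with 0 in L by lra.
      replace (v1 * v1 + v2 * v2) with (u1 * u1 + u2 * u2) in L by lra.
      rewrite D in L.
      assert (P0 : 0 < u1 * u1 + u2 * u2) by lra.
      pose proof (Rmult_lt_0_compat _ _ P0 P0). lra. }
    split; apply Rmult_eq_reg_r with (2 := D); rewrite Rmult_0_l.
    - transitivity (v2 * (xc n * u1 + yc n * u2 + zc n * 0) - u2 * (xc n * v1 + yc n * v2 + zc n * 0));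
        [ring|rewrite Na, Nb; ring].
    - transitivity (u1 * (xc n * v1 + yc n * v2 + zc n * 0) - v1 * (xc n * u1 + yc n * u2 + zc n * 0));
        [ring|rewrite Na, Nb; ring]. }
  destruct N12 as [N1 N2].
  assert (N3 : zc n <> 0).
  { intros N3. apply Hn. destruct n as [[n1 n2] n3]. unfold xc, yc, zc in *; cbn [fst snd] in *.
    rewrite N1, N2, N3; reflexivity. }
  (* The vertical translation that brings the point [p] of [P] to height zero. *)
  exists (0, 0, - zc p). intros v. rewrite HP.
  assert (E : dot (minus v p) n = (zc v - zc p) * zc n).
  { transitivity ((xc v - xc p) * xc n + (yc v - yc p) * yc n + (zc v - zc p) * zc n);
      [reflexivity|rewrite N1, N2; ring]. }
  rewrite E. unfold xy_plane.
  change (zc (plus v (0, 0, - zc p))) with (zc v + - zc p).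
  split; intros K.
  - apply Rmult_integral in K. destruct K; [lra|contradiction].
  - replace (zc v - zc p) with 0 by lra. ring.
Qed.

Theorem theorem1p3 :
  forall (U : R * R -> Prop) (X : R -> R -> V3) (C : circle_family),
    dirichlet_minimal_surface U X ->
    ~ planar U X ->
    foliated_by U X C ->
    forall P : V3 -> Prop, foliation_plane C P -> parallel P xy_plane.
Proof.
  intros U X C minimal Hplanar Hfol P (HP & s & Hs & Hc).
  apply (horizontal_circle_plane C s); auto.
  - exact (proj1 Hfol).
  - destruct (Req_dec (tilt C s) 0) as [E|E]; [exact E|].
    exfalso; apply Hplanar. exact (tilted_circles_planar U X C s minimal Hfol Hs E).
Qed.
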